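(* Let $\alpha>-\frac12$, $\beta\ge-\frac12$, $\alpha>\beta$, and let $M=\begin{pmatrix}a&b\\c&d\end{pmatrix}$ be a matrix with $|M|=\det M=1$. Let $f,r\in L^2_{\alpha,\beta}(\mathbb{R})$, and define the convolution of $f$ and $r$ by $$(f*r)(x)=\int_{\mathbb{R}}f(t)\,r(x-t)\,B_{\alpha,\beta}^{M}(x-t)\,dt,$$ where $$B_{\alpha,\beta}^{M}(x-t)=\frac{\Psi_{\alpha,\beta}^{M}(x-t,\lambda)\,\Psi_{\alpha,\beta}^{M}(t,\lambda)\,A_{\alpha,\beta}(x-t)}{\Psi_{\alpha,\beta}^{M}(x,\lambda)\,A_{\alpha,\beta}(x)}\,A_{\alpha,\beta}(t)$$ is a weight function. Then $$\mathcal{L}_{\alpha,\beta}^{M}(f*r)(\lambda)=\mathcal{L}_{\alpha,\beta}^{M}(f)(\lambda)\cdot\mathcal{L}_{\alpha,\beta}^{M}(r)(\lambda).$$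
   Context: Put $\rho=\alpha+\beta+1$ and $A_{\alpha,\beta}(x)=2^{2\rho}\sinh^{2\alpha+1}(|x|)\cosh^{2\beta+1}(x)$. $L^p_{\alpha,\beta}(\mathbb{R})$ is the space of measurable functions $f$ on $\mathbb{R}$ with $\int_{\mathbb{R}}|f(x)|^pA_{\alpha,\beta}(x)\,dx<\infty$. For $\lambda\in\mathbb{C}$, the Jacobi-Dunkl kernel is $$\psi_\lambda^{\alpha,\beta}(x)=\begin{cases}\phi_\mu^{(\alpha,\beta)}(x)-\dfrac{i}{\lambda}\dfrac{d}{dx}\phi_\mu^{(\alpha,\beta)}(x),&\lambda\neq0,\\1,&\lambda=0,\end{cases}$$ where $\mu^2=\lambda^2-\rho^2$ and $\phi_\mu^{(\alpha,\beta)}(x)={}_2F_1\left(\frac{\rho+i\mu}{2},\frac{\rho-i\mu}{2};\alpha+1;-(\sinh x)^2\right)$ with ${}_2F_1$ the Gauss hypergeometric function. The linear canonical Jacobi-Dunkl kernel is $$\Psi_{\alpha,\beta}^{M}(x,\lambda)=\begin{cases}e^{-\frac{i}{2b}(ax^2+d\lambda^2)}\psi_{-\lambda/c}^{\alpha,\beta}(x),&c\neq0,\\ \psi_\lambda^{\alpha,\beta}(x),&c=0\end{cases}$$ (the first formula presupposes $b\neq0$). The linear canonical Jacobi-Dunkl transform of a function $g$ (defined in the first instance for $g\in L^1_{\alpha,\beta}(\mathbb{R})$) is $\mathcal{L}_{\alpha,\beta}^{M}(g)(\lambda)=\int_{\mathbb{R}}g(x)\Psi_{\alpha,\beta}^{M}(x,\lambda)A_{\alpha,\beta}(x)\,dx$.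 The weight written $B_{\alpha,\beta}^{M}(x-t)$ depends on $x$, $t$ and $\lambda$ (not only on $x-t$); the same $\lambda$ is used in the weight and in the transform.
   Formalization: Besides f, r in L², it is assumed that the integrals defining the transforms of f and r converge absolutely at the given λ; L² alone does not ensure this, e.g. for c=0, λ=0, f = A^{-1/2}/(1+|x|) for |x|>1 and 0 elsewhere. *)

(* Defs.v *)
From HB Require Import structures.
From mathcomp Require Import all_boot all_order all_algebra.
From mathcomp Require Import all_classical all_reals all_analysis.
From mathcomp Require Export complex.
Set Implicit Arguments.
Unset Strict Implicit.
Unset Printing Implicit Defensive.
Import Order.TTheory GRing.Theory Num.Theory numFieldNormedType.Exports.
Import ComplexField.Normc.

Local Open Scope classical_set_scope.
Local Open Scope ring_scope.
Local Open Scope complex_scope.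

(* Limits, derivatives and integrals of functions with values in R[i] are
   taken on real and imaginary parts. *)

Section ComplexValued.
Variable R : realType.
Local Notation C := R[i].
Local Notation mu := (@lebesgue_measure R).

Definition expc (z : C) : C :=
  (expR (complex.Re z) * cos (complex.Im z)) +i*
  (expR (complex.Re z) * sin (complex.Im z)).

Definition seriesc (u : nat -> C) : C :=
  limn (series (fun n => complex.Re (u n))) +i*
  limn (series (fun n => complex.Im (u n))).

Definition derivec (f : R -> C) (x : R) : C :=
  derive1 (fun y => complex.Re (f y)) x +i*
  derive1 (fun y => complex.Im (f y)) x.

Definition measurablec (f : R -> C) : Prop :=
  measurable_fun [set: R] (fun x => complex.Re (f x)) /\
  measurable_fun [set: R] (fun x => complex.Im (f x)).

Definition integrablec (f : R -> C) : Prop :=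
  mu.-integrable [set: R] (fun x => (complex.Re (f x))%:E) /\
  mu.-integrable [set: R] (fun x => (complex.Im (f x))%:E).

Definition integralc (f : R -> C) : C :=
  (\int[mu]_x complex.Re (f x)) +i* (\int[mu]_x complex.Im (f x)).

End ComplexValued.

Section JacobiDunkl.
Variable R : realType.
Local Notation C := R[i].
Local Notation mu := (@lebesgue_measure R).

Local Notation i_C := (0 +i* 1 : C).

Definition sinhR (x : R) : R := (expR x - expR (- x)) / 2.
Definition coshR (x : R) : R := (expR x + expR (- x)) / 2.

Definition pochhammer (a : C) (n : nat) : C := \prod_(k < n) (a + k%:R).

Definition gauss_series (a b c : C) (z : R) : C :=
  seriesc (fun n => pochhammer a n * pochhammer b n /
                    (pochhammer c n * (n`!)%:R) * (z%:C) ^+ n).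

(* 2F1(a, b; c; z) for a real argument z < 1: the Gauss series where it
   converges, and for z <= -1 the analytic continuation of that series along
   the negative axis, given by Pfaff's transformation (DLMF 15.8.1)
     2F1(a, b; c; z) = (1 - z)^(-a) 2F1(a, c - b; c; z / (z - 1)),
   where 1 - z > 0, the power is the principal one, and z / (z - 1) lies in
   [1/2, 1[. *)
Definition gauss_2F1 (a b c : C) (z : R) : C :=
  if `|z| < 1 then gauss_series a b c z
  else expc (- a * (ln (1 - z))%:C) * gauss_series a (c - b) c (z / (z - 1)).

Definition jacobi_rho (alpha beta : R) : R := alpha + beta + 1.

Definition jacobi_weight (alpha beta x : R) : R :=
  2 `^ (2 * jacobi_rho alpha beta) *
  (sinhR `|x|) `^ (2 * alpha + 1) * (coshR x) `^ (2 * beta + 1).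

Definition Lp_jacobi (p alpha beta : R) (f : R -> C) : Prop :=
  measurablec f /\
  (\int[mu]_x ((normc (f x)) `^ p * jacobi_weight alpha beta x)%:E < +oo)%E.

Definition jacobi_function (alpha beta : R) (m : C) (x : R) : C :=
  let rho := (jacobi_rho alpha beta)%:C in
  gauss_2F1 ((rho + i_C * m) / 2%:R) ((rho - i_C * m) / 2%:R)
            (alpha + 1)%:C (- (sinhR x) ^+ 2).

(* jacobi_function is even in m, so either square root of
   lambda^2 - rho^2 may serve as m. *)
Definition jacobi_dunkl_kernel (alpha beta : R) (lambda : C) (x : R) : C :=
  if lambda == 0 then 1
  else
    let m := sqrtc (lambda ^+ 2 - (jacobi_rho alpha beta)%:C ^+ 2) in
    jacobi_function alpha beta m x -
    i_C / lambda * derivec (jacobi_function alpha beta m) x.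

(* M = (a b; c d); when c != 0 the formula is meaningful only for b != 0. *)
Definition lc_kernel (alpha beta : R) (M : 'M[R]_2) (x : R) (lambda : C) : C :=
  let a := M 0 0 in let b := M 0 1 in let c := M 1 0 in let d := M 1 1 in
  if c != 0 then
    expc (- (i_C / (2 * b)%:C) * ((a * x ^+ 2)%:C + d%:C * lambda ^+ 2)) *
    jacobi_dunkl_kernel alpha beta (- lambda / c%:C) x
  else jacobi_dunkl_kernel alpha beta lambda x.

Definition lc_integrand (alpha beta : R) (M : 'M[R]_2) (g : R -> C)
    (lambda : C) (x : R) : C :=
  g x * lc_kernel alpha beta M x lambda * (jacobi_weight alpha beta x)%:C.

Definition lc_transformable (alpha beta : R) (M : 'M[R]_2) (g : R -> C)
    (lambda : C) : Prop :=
  integrablec (lc_integrand alpha beta M g lambda).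

Definition lc_transform (alpha beta : R) (M : 'M[R]_2) (g : R -> C)
    (lambda : C) : C :=
  integralc (lc_integrand alpha beta M g lambda).

(* The weight written B(x - t); it depends on x, t and lambda. *)
Definition lc_conv_weight (alpha beta : R) (M : 'M[R]_2) (lambda : C)
    (x t : R) : C :=
  lc_kernel alpha beta M (x - t) lambda * lc_kernel alpha beta M t lambda *
    (jacobi_weight alpha beta (x - t))%:C /
  (lc_kernel alpha beta M x lambda * (jacobi_weight alpha beta x)%:C) *
  (jacobi_weight alpha beta t)%:C.

Definition lc_conv_integrand (alpha beta : R) (M : 'M[R]_2) (lambda : C)
    (f r : R -> C) (x t : R) : C :=
  f t * r (x - t) * lc_conv_weight alpha beta M lambda x t.

Definition lc_conv (alpha beta : R) (M : 'M[R]_2) (lambda : C)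
    (f r : R -> C) (x : R) : C :=
  integralc (lc_conv_integrand alpha beta M lambda f r x).

End JacobiDunkl.

(* Main.v *)
Require Import Defs.
From HB Require Import structures.
From mathcomp Require Import all_boot all_order all_algebra.
From mathcomp Require Import all_classical all_reals all_analysis.
From mathcomp Require Import measurable_realfun ring lra zify.
Import Order.TTheory GRing.Theory Num.Theory numFieldNormedType.Exports.
Local Open Scope classical_set_scope.
Local Open Scope ring_scope.
Local Open Scope complex_scope.

(** Write [k x] for the kernel at [x] times the weight at [x], and let
    [F = f k] and [G = r k].  These are the integrands of the two transforms
    on the right-hand side, so they are integrable.  The convolution weight is
    designed so that the convolution integrand at [(x, t)] is
    [F t * G (x - t) / k x], while the transform multiplies the result by [k x]
    again.  Wherever [k x] does not vanish the two factors cancel, and what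
    remains is the ordinary additive convolution of [F] and [G]; Fubini's
    theorem and the translation invariance of Lebesgue measure give
    [integral of F * integral of G] ([weighted_convolution]).

    The real issue is the cancellation: it needs [k] to be measurable and
    nonzero almost everywhere.  The weight vanishes only at 0 and the
    exponential factor never vanishes, so the question is the zero set of the
    Jacobi-Dunkl kernel [psi = phi - (i / l) phi'], where [l] is the spectral
    parameter and may be complex.  On each of the regions [sinh^2 x < 1] and
    [sinh^2 x > 1] the function [phi] is an explicit nonvanishing factor [E]
    times [F (v x)], where [F] is a Gauss series with [F 0 = 1]; the variable
    [v] is [- sinh^2 x] in the first region and, after Pfaff's transformation,
    [tanh^2 x] in the second.  The chain rule turns
    [psi x = 0] into [F v = (i / l) tau (e0 F v + m v F' v)], where [tau] is not
    a power series in [v] but its square [kappa v] is.  Squaring the equation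
    therefore gives [K (v x) = 0] for
    [K = F^2 + l^-2 kappa (e0 F + m F')^2], a function analytic on the interval
    from -1 to 1, with [K 0 = 1] because [kappa 0 = 0] ([psi_zeros]).  Note that
    in the second region the base point 0 of the power series lies outside the
    range of [v]; only analyticity on the whole interval matters.

    By the identity theorem ([countable_zeros]) the zeros of [K] in that
    interval are countable.  Since [v] takes each value at most twice, the
    zeros of [psi] are countable as well, hence negligible.  The same local
    formulas show that [psi] is continuous off the set [sinh^2 x = 1], which
    has at most two points, and measurability follows ([measurablec_psi]). *)

Set Implicit Arguments.
Unset Strict Implicit.
Unset Printing Implicit Defensive.

(** * Derivatives of real functions, in pointwise form *)

Section RealDerivatives.
Variable R : realType.
Implicit Types (f g : R -> R) (x a b : R).

Lemma is_derive_addf f g x a b :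
  is_derive x 1 f a -> is_derive x 1 g b ->
  is_derive x 1 (fun y => f y + g y) (a + b).
Proof. by move=> df dg; exact: is_deriveD df dg. Qed.

Lemma is_derive_oppf f x a :
  is_derive x 1 f a -> is_derive x 1 (fun y => - f y) (- a).
Proof. by move=> df; exact: is_deriveN df. Qed.

Lemma is_derive_mulf f g x a b :
  is_derive x 1 f a -> is_derive x 1 g b ->
  is_derive x 1 (fun y => f y * g y) (a * g x + f x * b).
Proof.
move=> df dg; apply: (is_derive_eq (is_deriveM df dg)).
by rewrite /GRing.scale/= addrC mulrC.
Qed.

Lemma is_derive_mulc f x a (c : R) :
  is_derive x 1 f a -> is_derive x 1 (fun y => c * f y) (c * a).
Proof. by move=> df; exact: (is_deriveZ c df). Qed.

Lemma is_derive_sumf n (h : nat -> R -> R) (dh : nat -> R) x :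
  (forall i, (i < n)%N -> is_derive x 1 (h i) (dh i)) ->
  is_derive x 1 (fun y => \sum_(i < n) h i y) (\sum_(i < n) dh i).
Proof.
elim: n => [|n IH] H.
  rewrite big_ord0 (_ : (fun y => _) = cst 0); first exact: is_derive_cst.
  by apply/funext => y; rewrite big_ord0.
rewrite big_ord_recr/= (_ : (fun y => _) = fun y => \sum_(i < n) h i y + h n y).
  by apply: is_derive_addf; [apply: IH => i ?; apply: H; exact: ltnW|exact: H].
by apply/funext => y; rewrite big_ord_recr.
Qed.

Lemma is_derive_expn n x : is_derive x 1 (fun y : R => y ^+ n.+1) (n.+1%:R * x ^+ n).
Proof.
elim: n => [|n IH].
  by rewrite expr0 mulr1; exact: is_derive_id.
rewrite (_ : (fun y => _) = fun y => y * y ^+ n.+1); last first.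
  by apply/funext => y; rewrite exprS.
apply: (is_derive_eq (is_derive_mulf (is_derive_id x 1) IH)).
by rewrite [x ^+ n.+1]exprS -[in RHS]natr1; ring.
Qed.

End RealDerivatives.

(** * Real-analytic functions on the open unit interval *)

Section Analytic.
Variable R : realType.
Implicit Types (f g : R -> R) (T : nat -> R -> R) (r s x y : R) (u : nat -> R).

(** [T n x] plays the role of the [n]-th derivative at [x] divided by [n!].
    The geometric bound, uniform on each smaller interval, is what separates
    analytic from merely smooth functions.  Describing analyticity this way
    avoids re-expanding power series at other base points. *)
Definition taylor_coefs T :=
  (forall n x, `|x| < 1 -> is_derive x 1 (T n) (n.+1%:R * T n.+1 x)) /\
  (forall r, 0 < r -> r < 1 -> exists C M, [/\ 0 < C, 1 <= M &
     forall n x, `|x| <= r -> `|T n x| <= C * M ^+ n]).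

Definition analytic f := exists T, taylor_coefs T /\ T 0%N = f.

Lemma analytic_derivable f x : analytic f -> `|x| < 1 -> derivable f x 1.
Proof. by case=> T [[dT _] <-] x1; have [] := dT 0%N _ x1. Qed.

Lemma analytic_cst c : analytic (fun=> c).
Proof.
exists (fun n => if n is 0%N then fun=> c else fun=> 0); split=> //; split.
  case=> [|n] x _; rewrite mulr0; exact: is_derive_cst.
move=> r r0 r1; exists (`|c| + 1), 1; split=> //.
move=> [|n] x _; rewrite expr1n mulr1; first by rewrite lerDl.
by rewrite normr0 addr_ge0.
Qed.

Lemma analytic_id : analytic id.
Proof.
exists (fun n => match n with 0%N => id | 1%N => cst 1 | _ => cst 0 end).
split=> //; split.
  case=> [|[|n]] x _; rewrite ?mulr0 ?mulr1; exact: is_derive_cst || exact: is_derive_id.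
move=> r r0 r1; exists 1, 1; split=> //.
move=> [|[|n]] x xr; rewrite expr1n mulr1; rewrite /cst ?normr1 ?normr0 //.
by rewrite (le_trans xr) ?ltW.
Qed.

Lemma analyticD f g : analytic f -> analytic g -> analytic (fun x => f x + g x).
Proof.
case=> S [[dS bS] <-] [T [[dT bT] <-]].
exists (fun n x => S n x + T n x); split=> //; split.
  by move=> n x x1; rewrite mulrDr; exact: is_derive_addf (dS _ _ x1) (dT _ _ x1).
move=> r r0 r1; have [C [M [C0 M1 HS]]] := bS r r0 r1.
have [D [N [D0 N1 HT]]] := bT r r0 r1.
exists (C + D), (M * N); split; [exact: addr_gt0| by rewrite -[1]mulr1 ler_pM|].
move=> n x xr; rewrite (le_trans (ler_normD _ _))// mulrDl exprMn.
have M0 : 0 <= M by exact: le_trans ler01 M1.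
have N0 : 0 <= N by exact: le_trans ler01 N1.
apply: lerD; [apply: le_trans (HS n x xr) _|apply: le_trans (HT n x xr) _].
  by apply: ler_wpM2l; [exact: ltW|rewrite ler_peMr ?exprn_ege1 ?exprn_ge0].
by apply: ler_wpM2l; [exact: ltW|rewrite ler_peMl ?exprn_ege1 ?exprn_ge0].
Qed.

(** Because the coefficients are divided by [n!], the Leibniz rule becomes the
    Cauchy product without binomial coefficients. *)
Lemma analyticM f g : analytic f -> analytic g -> analytic (fun x => f x * g x).
Proof.
case=> S [[dS bS] <-] [T [[dT bT] <-]].
exists (fun n x => \sum_(i < n.+1) S i x * T (n - i)%N x); split; last first.
  by apply/funext => x; rewrite big_ord_recl big_ord0 addr0.
split.
  move=> n x x1.
  have dST i : is_derive x 1 (fun y => S i y * T (n - i)%N y)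
      (i.+1%:R * S i.+1 x * T (n - i)%N x + S i x * ((n - i).+1%:R * T (n - i).+1 x)).
    exact: is_derive_mulf (dS i x x1) (dT (n - i)%N x x1).
  apply: (is_derive_eq (is_derive_sumf (n := n.+1) (fun i _ => dST i))).
  rewrite big_split/= mulr_sumr.
  transitivity (\sum_(i < n.+2) i%:R * (S i x * T (n.+1 - i)%N x) +
                \sum_(i < n.+2) (n.+1 - i)%N%:R * (S i x * T (n.+1 - i)%N x)).
    congr (_ + _).
      rewrite [RHS]big_ord_recl/= mul0r add0r; apply: eq_bigr => i _.
      by rewrite /bump/= add1n subSS mulrA.
    rewrite [RHS]big_ord_recr/= subnn mul0r addr0; apply: eq_bigr => i _.
    by rewrite subSn ?leq_ord// [LHS]mulrCA.
  rewrite -big_split/=; apply: eq_bigr => i _.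
  by rewrite -mulrDl -natrD subnKC// -ltnS.
move=> r r0 r1; have [C [M [C0 M1 HS]]] := bS r r0 r1.
have [D [N [D0 N1 HT]]] := bT r r0 r1.
exists (C * D), (2 * (M * N)); split; first exact: mulr_gt0.
  have : 1 <= M * N by rewrite -[1]mulr1 ler_pM.
  lra.
move=> n x xr; rewrite (le_trans (ler_norm_sum _ _ _))//.
have M0 : 0 <= M by exact: le_trans ler01 M1.
have N0 : 0 <= N by exact: le_trans ler01 N1.
apply: (@le_trans _ _ (\sum_(i < n.+1) C * D * (M * N) ^+ n)).
  apply: ler_sum => i _; rewrite normrM.
  apply: (@le_trans _ _ ((C * M ^+ i) * (D * N ^+ (n - i)))).
    by apply: ler_pM => //; [exact: HS|exact: HT].
  rewrite mulrACA; apply: ler_wpM2l; first by apply: mulr_ge0; exact: ltW.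
  rewrite exprMn ler_pM ?exprn_ge0//.
    by rewrite ler_weXn2l// -ltnS.
  by rewrite ler_weXn2l// leq_subr.
rewrite sumr_const card_ord -[leLHS]mulr_natr [(2 * (M * N)) ^+ n]exprMn.
rewrite -mulrA ler_pM2l ?mulr_gt0// mulrC ler_pM2r; last first.
  by rewrite exprn_gt0// mulr_gt0// (lt_le_trans ltr01).
by rewrite -natrX ler_nat ltn_expl.
Qed.

(** If [T n] are the Taylor coefficients of [f], then [(n + 1) T (n + 1)] are
    those of [f']; the factor [n + 1 <= 2 ^ n] is absorbed in the ratio of the
    geometric bound. *)
Lemma analytic_derive f : analytic f ->
  exists2 f', analytic f' & forall x, `|x| < 1 -> is_derive x 1 f (f' x).
Proof.
case=> T [[dT bT] <-]; exists (T 1%N); last first.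
  by move=> x x1; apply: is_derive_eq (dT _ _ x1) _; rewrite mul1r.
exists (fun n x => n.+1%:R * T n.+1 x); split; last first.
  by apply/funext => x; rewrite mul1r.
split=> [n x x1|r r0 r1].
  exact: is_derive_mulc (dT n.+1 x x1).
have [C [M [C0 M1 HT]]] := bT r r0 r1.
have M0 : 0 < M by exact: lt_le_trans ltr01 M1.
exists (C * M), (2 * M); split; [exact: mulr_gt0|lra|].
move=> n x xr; rewrite normrM ger0_norm//.
apply: (@le_trans _ _ (2 ^+ n * (C * M ^+ n.+1))).
  apply: ler_pM => //; last exact: HT.
  by rewrite -natrX ler_nat ltn_expl.
by rewrite exprS exprMn !mulrA ler_wpM2r ?exprn_ge0 ?(ltW M0)// -!mulrA mulrC -!mulrA.
Qed.

(** One integration step of Taylor's theorem: a bound of order [j] on the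
    derivative gives a bound of order [j + 1] on the function, with the gain
    [1 / (j + 1)] that a plain mean value estimate would lose.  It follows from
    the mean value theorem applied to the difference between the bound and
    [f], or [- f], along the segment from [x0] to [x]. *)
Lemma norm_power_bound f (df : R -> R) (x0 x B : R) j :
  0 <= B ->
  (forall t : R, 0 <= t -> t <= 1 ->
     is_derive (x0 + t * (x - x0)) 1 f (df (x0 + t * (x - x0))) /\
     `|df (x0 + t * (x - x0))| <= B * (t * `|x - x0|) ^+ j) ->
  f x0 = 0 -> `|f x| <= B * `|x - x0| ^+ j.+1 / j.+1%:R.
Proof.
move=> B0 H fx0.
set h := x - x0.
have key (e : R) : `|e| = 1 -> e * f x <= B * `|h| ^+ j.+1 / j.+1%:R.
  move=> e1.
  pose G := fun t : R => (B * `|h| ^+ j.+1 / j.+1%:R) * t ^+ j.+1 - e * f (x0 + t * h).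
  pose dG := fun t : R => B * `|h| ^+ j.+1 * t ^+ j - e * (df (x0 + t * h) * h).
  have dGP (t : R) : 0 <= t -> t <= 1 -> is_derive t 1 G (dG t).
    move=> t0 t1; have [d1 _] := H t t0 t1.
    have d2 : is_derive t 1 (fun t : R => x0 + t * h) h.
      apply: (is_derive_eq (is_derive_addf (is_derive_cst x0 t 1)
        (is_derive_mulf (is_derive_id t 1) (is_derive_cst h t 1)))).
      by rewrite mul1r mulr0 addr0 add0r.
    have d3 := is_derive1_comp (g := fun t => x0 + t * h) d1 d2.
    have d4 := is_derive_expn j t.
    apply: (is_derive_eq (is_derive_addf
      (is_derive_mulc (B * `|h| ^+ j.+1 / j.+1%:R) d4)
      (is_derive_oppf (is_derive_mulc e d3)))).
    by rewrite /dG [_ / j.+1%:R * _]mulrA divfK.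
  have [c c01] : exists2 c, c \in `[0, 1] & G 1 - G 0 = dG c * (1 - 0).
    apply: (MVT_segment (f := G) (df := dG) ler01).
      by move=> t; rewrite in_itv/= => /andP[t0 t1]; apply: dGP; exact: ltW.
    apply: derivable_within_continuous => t; rewrite in_itv/= => /andP[t0 t1].
    by have [] := dGP t t0 t1.
  have x0h : x0 + h = x by rewrite /h addrC subrK.
  rewrite subr0 mulr1 /G expr1n mulr1 mul0r mul1r expr0n/= mulr0 addr0 x0h.
  rewrite fx0 mulr0 !subr0 -subr_ge0 => ->.
  move: c01; rewrite in_itv/= => /andP[c0 c1].
  have [_ b] := H c c0 c1.
  rewrite /dG subr_ge0 (le_trans (ler_norm _))// !normrM e1 mul1r.
  apply: (@le_trans _ _ (B * (c * `|h|) ^+ j * `|h|)).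
    by rewrite ler_wpM2r.
  by rewrite exprMn exprS -!mulrA ler_wpM2l// mulrC -!mulrA mulrCA mulrA mulrC.
have := key 1 (normr1 _); rewrite mul1r => h1.
have := key (-1); rewrite normrN1 mulN1r => /(_ erefl) h2.
by rewrite ler_norml h1 lerNl h2.
Qed.

(** Iterating [norm_power_bound] [j] times bounds [T k x] by
    [C M^(k + j) binomial(k + j, j) |x - x0|^j], which tends to 0 with [j]
    because [binomial(k + j, j) <= 2^(k + j)] and [2 M |x - x0| <= 1/2].  The
    admissible radius [1 / (4 M)] is the same for all [x0] in the interval. *)
Lemma vanishing_coefs_nearby T (r C M x0 x : R) :
  (forall n x, `|x| < 1 -> is_derive x 1 (T n) (n.+1%:R * T n.+1 x)) ->
  r < 1 -> 0 < C -> 1 <= M ->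
  (forall n x, `|x| <= r -> `|T n x| <= C * M ^+ n) ->
  `|x0| <= r -> `|x| <= r -> `|x - x0| <= (4 * M)^-1 ->
  (forall n, T n x0 = 0) -> forall n, T n x = 0.
Proof.
move=> dT r1 C0 M1 bT x0r xr xx0 T0 n.
have M0 : 0 < M by exact: lt_le_trans ltr01 M1.
have seg y t : `|y| <= r -> 0 <= t -> t <= 1 -> `|x0 + t * (y - x0)| <= r.
  move=> yr t0 t1; rewrite (_ : _ + _ = (1 - t) * x0 + t * y); last by ring.
  rewrite (le_trans (ler_normD _ _))// !normrM (ger0_norm t0) ger0_norm ?subr_ge0//.
  have : (1 - t) * `|x0| <= (1 - t) * r by rewrite ler_wpM2l// subr_ge0.
  have : t * `|y| <= t * r by rewrite ler_wpM2l.
  lra.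
have main j : forall k y, `|y| <= r ->
    `|T k y| <= C * M ^+ (k + j) * 'C(k + j, j)%:R * `|y - x0| ^+ j.
  elim: j => [|j IH] k y yr.
    by rewrite addn0 bin0 !mulr1; exact: bT.
  have := @norm_power_bound (T k) (fun y => k.+1%:R * T k.+1 y) x0 y
    (k.+1%:R * (C * M ^+ (k.+1 + j) * 'C(k.+1 + j, j)%:R)) j.
  move=> /(_ _ _ (T0 k)) H.
  apply: le_trans (H _ _) _.
  - by rewrite !mulr_ge0// ?exprn_ge0// ltW.
  - move=> t t0 t1; have st := seg y t yr t0 t1; split.
      by apply: dT; exact: le_lt_trans st r1.
    rewrite normrM ger0_norm// -mulrA ler_wpM2l//.
    rewrite (le_trans (IH k.+1 _ st))// ler_wpM2l//.
      by rewrite !mulr_ge0// ?exprn_ge0// ltW.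
    by rewrite addrC addKr normrM (ger0_norm t0).
  - rewrite addSnnS.
    rewrite [X in X <= _](_ : _ = C * M ^+ (k + j.+1) * (k.+1%:R * 'C(k + j.+1, j)%:R / j.+1%:R)
      * `|y - x0| ^+ j.+1); last by ring.
    rewrite le_eqVlt; apply/orP; left; apply/eqP; congr (_ * _ * _).
    apply: (mulIf (_ : j.+1%:R != 0)) => //.
    rewrite divfK// -!natrM; congr (_%:R).
    by rewrite [RHS]mulnC mul_bin_left addnS -addSn addnK.
apply/eqP; rewrite -normr_eq0 eq_le normr_ge0 andbT.
have geo : geometric (C * (2 * M) ^+ n) (2^-1 : R) @ \oo --> 0.
  by apply: cvg_geometric; rewrite ger0_norm ?invr_ge0// invf_lt1// ltr1n.
rewrite -(cvg_lim _ geo)//; apply: limr_ge; first by apply/cvg_ex; exists 0.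
apply: nearW => j /=; rewrite /geometric/=.
apply: le_trans (main j n x xr) _.
apply: (@le_trans _ _ (C * M ^+ (n + j) * 2 ^+ (n + j) * (4 * M)^-1 ^+ j)).
  have CM : 0 < C * M ^+ (n + j) by rewrite mulr_gt0// exprn_gt0.
  apply: ler_pM; [by rewrite mulr_ge0// ltW|by rewrite exprn_ge0| |].
    rewrite ler_pM2l// -natrX ler_nat (expnDn 1 1).
    rewrite (bigD1 (Ordinal (_ : j < (n + j).+1)%N)) ?ltnS ?leq_addl//=.
    by move=> ?; rewrite !exp1n !muln1 leq_addr.
  by rewrite lerXn2r ?nnegrE// invr_ge0 mulr_ge0// ltW.
rewrite -!mulrA ler_pM2l// !exprMn !exprD exprVn exprMn invfM -!exprVn.
rewrite (_ : 4^-1 = 2^-1 * 2^-1 :> R) ?exprMn; last by rewrite -invfM -natrM.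
rewrite [X in X <= _](_ : _ = (M ^+ j * M^-1 ^+ j) * (2 ^+ j * 2^-1 ^+ j) *
  (2 ^+ n * (M ^+ n * 2^-1 ^+ j))); last by ring.
have cancel (y : R) : 0 < y -> y ^+ j * y^-1 ^+ j = 1.
  by move=> y0; rewrite -exprMn divff ?gt_eqF// expr1n.
by rewrite !cancel// !mul1r mulrA.
Qed.

Lemma vanishing_coefs_at0 T x0 : taylor_coefs T -> `|x0| < 1 ->
  (forall n, T n x0 = 0) -> T 0%N 0 = 0.
Proof.
move=> [dT bT] x01 T0.
have [r [r0 r1 x0r]] : exists r, [/\ 0 < r, r < 1 & `|x0| <= r].
  by exists ((1 + `|x0|) / 2); have := normr_ge0 x0; split; lra.
have [C [M [C0 M1 H]]] := bT r r0 r1.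
have M0 : 0 < M by exact: lt_le_trans ltr01 M1.
(* since the radius is uniform, finitely many steps of length |x0| / N.+1 reach 0 *)
have [N Nx] : exists N, `|x0| * (4 * M) <= N.+1%:R.
  have Mx : 0 <= `|x0| * (4 * M) by rewrite !mulr_ge0// ltW.
  exists (Num.bound (`|x0| * (4 * M))).
  by rewrite -[leRHS]natr1 ler_wpDr// ltW// archi_boundP.
pose p (k : nat) := x0 * (1 - k%:R / N.+1%:R).
have pr k : (k <= N.+1)%N -> `|p k| <= r.
  move=> kN; rewrite normrM (le_trans _ x0r)// ler_piMr//.
  have k0 : 0 <= k%:R / N.+1%:R :> R by exact: divr_ge0.
  have k1 : k%:R / N.+1%:R <= 1 :> R by rewrite ler_pdivrMr// mul1r ler_nat.
  move: (k%:R / _) k0 k1 => q q0 q1.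
  by rewrite ger0_norm ?subr_ge0// lerBlDr lerDl.
have step k : (k <= N.+1)%N -> forall n, T n (p k) = 0.
  elim: k => [|k IH] kN n; first by rewrite /p mul0r subr0 mulr1.
  apply: (vanishing_coefs_nearby dT r1 C0 M1 H (pr k (ltnW kN)) (pr _ kN)).
    rewrite (_ : p k.+1 - p k = - x0 / N.+1%:R); last first.
      by rewrite /p -[k.+1%:R]natr1 mulrDl; ring.
    rewrite normrM normrN normfV normr_nat ler_pdivrMr// -ler_pdivrMl ?invr_gt0 ?mulr_gt0//.
    by rewrite invrK mulrC.
  exact: IH (ltnW kN).
have := step N.+1 (leqnn _) 0%N.
by rewrite /p divff// subrr mulr0.
Qed.

(** Rolle's theorem between the limit point [x0], itself a zero by continuity,
    and a nearby zero produces a zero of the derivative strictly between them,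
    hence different from [x0]. *)
Lemma limit_point_zeros f f' x0 :
  (forall x, `|x| < 1 -> is_derive x 1 f (f' x)) -> `|x0| < 1 ->
  limit_point [set x | `|x| < 1 /\ f x = 0] x0 ->
  f x0 = 0 /\ limit_point [set x | `|x| < 1 /\ f' x = 0] x0.
Proof.
move=> df x01 lim.
have cf x : `|x| < 1 -> {for x, continuous f}.
  by move=> /df[dfx _]; exact/differentiable_continuous/derivable1_diffP.
have fx0 : f x0 = 0.
  apply/eqP/negPn/negP => fx0.
  have /lim[y [_ [_ fy0]]] : nbhs x0 [set y | f y != 0].
    exact: (cvgr_neq0 (f x0) (cf x0 x01) fx0).
  by rewrite /= fy0 eqxx.
split=> // U /nbhs_ballP[e/= e0 eU].
pose d := Num.min e (1 - `|x0|).
have d0 : 0 < d by rewrite lt_min e0 subr_gt0.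
have [y [yx0 [y1 fy] yd]] := lim _ (nbhsx_ballx x0 d d0).
have bd z : `|z - x0| < d -> `|z| < 1.
  move=> zd; rewrite -(subrK x0 z) (le_lt_trans (ler_normD _ _))//.
  by rewrite -ltrBrDr (lt_le_trans zd)// ge_min lexx orbT.
have rolle a b : a < b -> f a = 0 -> f b = 0 ->
    (forall z, a <= z <= b -> `|z - x0| < d) -> (exists2 z, a < z < b & f' z = 0).
  move=> ab fa fb zd.
  have [|||z] := Rolle ab (f := f).
  - move=> z; rewrite in_itv/= => /andP[az zb].
    by have [] := df z (bd z (zd z _)); rewrite ?(ltW az) ?(ltW zb).
  - apply: derivable_within_continuous => z; rewrite in_itv/= => azb.
    by have [] := df z (bd z (zd z azb)).
  - by rewrite fa fb.
  rewrite in_itv/= => abz dz; exists z => //.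
  have azb : a <= z <= b by case/andP: abz => /ltW-> /ltW->.
  have [_ <-] := df z (bd z (zd z azb)).
  by have [_ <-] := dz.
have yd' : `|y - x0| < d by rewrite distrC.
have [z z1 [z2 z3]] : exists2 z, z != x0 & `|z - x0| < d /\ f' z = 0.
  case: (ltgtP y x0) yx0 => // yx0 _.
    have [|z /andP[z1 z2] z3] := rolle _ _ yx0 fy fx0.
      move=> z /andP[yz zx0]; rewrite distrC ger0_norm ?subr_ge0//.
      by move: yd'; rewrite distrC gtr0_norm ?subr_gt0//; lra.
    exists z; first by rewrite lt_eqF.
    split=> //; rewrite distrC gtr0_norm ?subr_gt0//.
    by move: yd'; rewrite distrC gtr0_norm ?subr_gt0//; lra.
  have [|z /andP[z1 z2] z3] := rolle _ _ yx0 fx0 fy.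
    move=> z /andP[x0z zy]; rewrite ger0_norm ?subr_ge0//.
    by move: yd'; rewrite gtr0_norm ?subr_gt0//; lra.
  exists z; first by rewrite gt_eqF.
  split=> //; rewrite gtr0_norm ?subr_gt0//.
  by move: yd'; rewrite gtr0_norm ?subr_gt0//; lra.
exists z; split=> //; first by split=> //; exact: bd.
apply: eU; rewrite /ball/= distrC (lt_le_trans z2)//.
by rewrite ge_min lexx.
Qed.

(** Identity theorem.  At a limit point of the zero set all Taylor
    coefficients vanish, by induction with [limit_point_zeros], and this
    propagates to the origin.  So every zero is isolated, and a set of isolated
    points of the line is countable. *)
Theorem countable_zeros f : analytic f -> f 0 != 0 ->
  countable [set x | `|x| < 1 /\ f x = 0].
Proof.
move=> [T [TT <-]] T00; have [dT bT] := TT.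
set Z := [set x | _].
suff -> : Z = isolated Z by exact: countable_isolated.
apply/seteqP; split; last exact: isolatedS.
move=> x Zx; have [//|xlim] : (isolated Z `|` limit_point Z) x.
  by rewrite -closure_isolated_limit_point; exact: subset_closure.
have x1 : `|x| < 1 by case: Zx.
have lim n : limit_point [set y | `|y| < 1 /\ T n y = 0] x.
  elim: n => [//|n IH].
  have [_ lim'] := limit_point_zeros (dT n) x1 IH.
  move=> U /lim' [y [yx [y1 /eqP yT] Uy]]; exists y; split=> //; split=> //.
  by apply/eqP; move: yT; rewrite mulf_eq0 pnatr_eq0.
exfalso; move/negP: T00; apply; apply/eqP; apply: (vanishing_coefs_at0 TT x1) => n.
by have [] := limit_point_zeros (dT n) x1 (lim n).
Qed.

End Analytic.

(** * Power series are analytic *)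

Section PowerSeries.
Variable R : realType.
Implicit Types (u : nat -> R) (x r s : R).

(** Equivalent to a radius of convergence at least 1. *)
Definition unit_radius u :=
  forall s, 0 < s -> s < 1 -> exists C, forall n, `|u n| * s ^+ n <= C.

(** Coefficients of the [n]-th derivative of the series divided by [n!]
    (the Hasse derivative). *)
Definition hasse n u (k : nat) : R := 'C(n + k, n)%:R * u (n + k)%N.

(** Separates the dependence on [n], needed for the Taylor bounds, from a
    geometric dependence on [k], needed for convergence. *)
Lemma hasse_bound u r : unit_radius u -> 0 < r -> r < 1 ->
  exists C M q, [/\ 0 < C, 1 <= M, 0 < q, q < 1 &
    forall n k x, `|x| <= r -> `|hasse n u k * x ^+ k| <= C * M ^+ n * q ^+ k].
Proof.
move=> hu r0 r1.
(* r < r + p < s < 1: the binomial coefficient is at most (r + p)^(n + k) / (p^n r^k) *)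
pose p := (1 - r) / 2; pose s := (3 + r) / 4.
have p0 : 0 < p by rewrite /p; lra.
have s0 : 0 < s by rewrite /s; lra.
have s1 : s < 1 by rewrite /s; lra.
have [C HC] := hu s s0 s1.
have C0 : 0 <= C by apply: le_trans (HC 0%N); rewrite mulr_ge0.
pose q := (p + r) / s.
have q0 : 0 < q by rewrite divr_gt0// addr_gt0.
have q1 : q < 1 by rewrite ltr_pdivrMr// mul1r /p /s; lra.
exists (C + 1), p^-1, q; split=> //; first by rewrite ltr_wpDl.
  by rewrite -invr1 lef_pV2 ?posrE// /p; lra.
move=> n k x xr; rewrite normrM normrX /hasse normrM ger0_norm//.
have bin : 'C(n + k, n)%:R * (p ^+ n * r ^+ k) <= (p + r) ^+ (n + k).
  rewrite [p + r]addrC exprDn (bigD1 (Ordinal (_ : n < (n + k).+1)%N)) ?ltnS ?leq_addr//=.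
  move=> ?; rewrite addKn [r ^+ k * _]mulrC -[X in _ <= X + _]mulr_natl lerDl sumr_ge0// => i _.
  by rewrite mulrn_wge0// mulr_ge0// exprn_ge0// ltW.
have uC : `|u (n + k)%N| <= C / s ^+ (n + k).
  by rewrite ler_pdivlMr ?exprn_gt0.
apply: (@le_trans _ _ ('C(n + k, n)%:R * (C / s ^+ (n + k)) * r ^+ k)).
  apply: ler_pM; [exact: mulr_ge0|exact: exprn_ge0|exact: ler_wpM2l|].
  by rewrite lerXn2r// nnegrE ltW.
rewrite [X in X <= _](_ : _ = 'C(n + k, n)%:R * (p ^+ n * r ^+ k) * (C / s ^+ (n + k) / p ^+ n)); last first.
  rewrite [RHS]mulrAC -!mulrA; congr (_ * _); rewrite !mulrA.
  by rewrite [in RHS]mulrC; field; rewrite !expf_neq0// gt_eqF.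
apply: (@le_trans _ _ ((p + r) ^+ (n + k) * (C / s ^+ (n + k) / p ^+ n))).
  by rewrite ler_wpM2r// !divr_ge0// exprn_ge0// ltW.
rewrite [X in X <= _](_ : _ = C * p^-1 ^+ n * q ^+ (n + k)); last first.
  rewrite /q [((p + r) / s) ^+ _]expr_div_n [p^-1 ^+ _]exprVn.
  by rewrite -!mulrA mulrCA; congr (_ * _); rewrite [RHS]mulrC -mulrA.
rewrite exprD mulrA ler_wpM2r ?exprn_ge0 ?(ltW q0)// mulrAC ler_wpM2r//.
  by rewrite exprn_ge0// invr_ge0 ltW.
rewrite (@le_trans _ _ C)// ?lerDl// ler_piMr//.
by rewrite exprn_ile1// ltW.
Qed.

Lemma cvg_hasse u n x : unit_radius u -> `|x| < 1 -> cvgn (pseries (hasse n u) x).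
Proof.
move=> hu x1.
have [C [M [q [C0 M1 q0 q1 H]]]] := @hasse_bound u ((1 + `|x|) / 2) hu
  ltac:(by have := normr_ge0 x; lra) ltac:(lra).
apply: normed_cvg; apply: (@series_le_cvg _ _ (geometric (C * M ^+ n) q)) => //=.
- by move=> k; rewrite /geometric/= !mulr_ge0// ?exprn_ge0//; rewrite ltW// (lt_le_trans ltr01).
- by move=> k; apply: H; lra.
- by apply: is_cvg_geometric_series; rewrite gtr0_norm.
Qed.

Lemma pseries_diffs_hasse u n :
  pseries_diffs (hasse n u) = (fun k => n.+1%:R * hasse n.+1 u k).
Proof.
apply/funext => k; rewrite /pseries_diffs /hasse addnS addSn !mulrA -!natrM.
congr (_%:R * _); rewrite mul_bin_left; congr (_ * _)%N; lia.
Qed.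

Lemma pseriesZ u c x : pseries (fun k => c * u k) x = (fun n => c * pseries u x n).
Proof.
by apply/funext => n; rewrite /pseries/series/= mulr_sumr; apply: eq_bigr => i _; rewrite mulrA.
Qed.

Lemma cvg_diffs_hasse u n c x : unit_radius u -> `|x| < 1 ->
  cvgn (pseries (fun k => c * hasse n u k) x).
Proof.
by move=> hu x1; rewrite pseriesZ; apply: is_cvgMl_tmp; exact: cvg_hasse.
Qed.

Lemma is_derive_hasse u n x : unit_radius u -> `|x| < 1 ->
  is_derive x 1 (fun y => limn (pseries (hasse n u) y))
    (n.+1%:R * limn (pseries (hasse n.+1 u) x)).
Proof.
move=> hu x1; pose K := (1 + `|x|) / 2.
have K0 : 0 < K by rewrite /K; have := normr_ge0 x; lra.
have K1 : `|K| < 1 by rewrite gtr0_norm// /K; lra.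
have -> : n.+1%:R * limn (pseries (hasse n.+1 u) x) =
    limn (pseries (pseries_diffs (hasse n u)) x).
  rewrite pseries_diffs_hasse pseriesZ; apply/esym/cvg_lim => //.
  by apply: cvgM; [exact: cvg_cst|exact: cvg_hasse].
apply: (@pseries_snd_diffs _ _ K).
- exact: cvg_hasse.
- by rewrite pseries_diffs_hasse; exact: cvg_diffs_hasse.
- rewrite pseries_diffs_hasse.
  rewrite (_ : pseries_diffs _ = fun k => (n.+1%:R * n.+2%:R) * hasse n.+2 u k).
    exact: cvg_diffs_hasse.
  apply/funext => k; have := congr1 (fun f => f k) (pseries_diffs_hasse u n.+1).
  by rewrite /pseries_diffs => E; rewrite mulrCA E mulrA.
- by rewrite (gtr0_norm K0) /K; lra.
Qed.

Lemma analytic_pseries u : unit_radius u ->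
  analytic (fun x => limn (pseries u x)).
Proof.
move=> hu; exists (fun n x => limn (pseries (hasse n u) x)); split; last first.
  apply/funext => x; congr (limn (pseries _ x)); apply/funext => k.
  by rewrite /hasse bin0 mul1r.
split=> [n x x1|r r0 r1]; first exact: is_derive_hasse.
have [C [M [q [C0 M1 q0 q1 H]]]] := hasse_bound hu r0 r1.
exists (C / (1 - q)), M; split=> //; first by rewrite divr_gt0// subr_gt0.
move=> n x xr; have x1 : `|x| < 1 by exact: le_lt_trans xr r1.
have cg : cvgn (series (geometric (C * M ^+ n) q)).
  by apply: is_cvg_geometric_series; rewrite gtr0_norm.
have cn : cvgn [normed pseries (hasse n u) x].
  apply: (@series_le_cvg _ _ (geometric (C * M ^+ n) q)) => //=.
  - by move=> k; rewrite /geometric/= !mulr_ge0// ?exprn_ge0//; rewrite ltW// (lt_le_trans ltr01).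
  - by move=> k; apply: H.
rewrite (le_trans (lim_series_norm cn))//.
rewrite mulrAC -(cvg_lim _ (cvg_geometric_series (_ : `|q| < 1)))//; last by rewrite gtr0_norm.
by apply: lim_series_le => // k; exact: H.
Qed.

Lemma pseries0 u : limn (pseries u 0) = u 0%N.
Proof.
apply: cvg_lim => //; apply: (cvg_trans _ (@cvg_cst _ (u 0%N) _ \oo _)).
apply: near_eq_cvg; near=> n.
have n0 : (0 < n)%N by near: n; exists 1%N.
rewrite /pseries/series/= -(prednK n0) big_nat_recl//= expr0 mulr1 big1 ?addr0// => i _.
by rewrite expr0n mulr0.
Unshelve. all: by end_near. Qed.

End PowerSeries.

(** * Convolution of integrable functions *)

Section Translation.
Variable R : realType.
Local Notation mR := (measurableTypeR R).
Local Notation mu := (@lebesgue_measure R).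

Lemma measurable_fun_shift (t : R) : measurable_fun [set: mR] (fun x : mR => x - t : mR).
Proof. by apply: measurable_funB => //; exact: measurable_id. Qed.

Lemma lebesgue_measure_shift (t : R) (A : set mR) : measurable A ->
  mu ((fun x : mR => x - t) @^-1` A) = mu A.
Proof.
move=> mA; have mphi := measurable_fun_shift t.
apply/esym.
apply: (@lebesgue_measure_unique R (measure_function_pushforward__canonical__measure_function_Measure mu mphi)) => //.
move=> X /ocitvP[->|[[a b] /= ab ->]]; rewrite /= /pushforward.
  by rewrite preimage_set0 measure0.
rewrite (_ : _ @^-1` _ = `](a + t), (b + t)]%classic); last first.
  by apply/seteqP; split=> x /=; rewrite !in_itv/= ltrBrDr lerBlDr.
rewrite !lebesgue_measure_itv/= !lte_fin ltrD2r.
by case: ifP => // _; rewrite -!EFinB; congr EFin; ring.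
Qed.

Lemma ge0_integral_shift (t : R) (f : mR -> \bar R) :
  measurable_fun setT f -> (forall x, (0 <= f x)%E) ->
  (\int[mu]_x f (x - t)%R = \int[mu]_x f x)%E.
Proof.
move=> mf f0; have mphi := measurable_fun_shift t.
rewrite -(@ge0_integral_pushforward _ _ _ _ _ _ mphi mu setT f)//.
by apply: eq_measure_integral => A mA _; exact: lebesgue_measure_shift.
Qed.

Lemma integrable_shift (t : R) (f : mR -> \bar R) :
  mu.-integrable setT f -> mu.-integrable setT (fun x => f (x - t)).
Proof.
move=> /integrableP[mf foo]; have mphi := measurable_fun_shift t.
apply/integrableP; split; first exact: (measurableT_comp mf mphi).
rewrite (ge0_integral_shift t (f := fun x => `|f x|%E))//.
exact: measurableT_comp.
Qed.

Lemma integral_shift (t : R) (f : mR -> \bar R) : mu.-integrable setT f ->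
  (\int[mu]_x f (x - t)%R = \int[mu]_x f x)%E.
Proof.
move=> fi; have mphi := measurable_fun_shift t.
have mf := measurable_int _ fi.
rewrite -(@integral_pushforward _ _ _ _ _ _ mphi mu setT f)//; last first.
  exact: integrable_shift.
by apply: eq_measure_integral => A mA _; exact: lebesgue_measure_shift.
Qed.

End Translation.

Section RealConvolution.
Variable R : realType.
Local Notation mR := (measurableTypeR R).
Local Notation mu := (@lebesgue_measure R).
Variables f g : mR -> R.
Hypothesis fi : mu.-integrable setT (EFin \o f).
Hypothesis gi : mu.-integrable setT (EFin \o g).

Definition conv_fun (z : mR * mR) : R := f z.2 * g (z.1 - z.2).

Lemma measurable_conv_fun : measurable_fun setT conv_fun.
Proof.
have mf : measurable_fun setT f by apply/measurable_EFinP; exact: measurable_int fi.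
have mg : measurable_fun setT g by apply/measurable_EFinP; exact: measurable_int gi.
apply: measurable_funM; first exact: measurableT_comp.
apply: (measurableT_comp mg).
by apply: measurable_funB.
Qed.

(** Tonelli: the inner integral over the first variable is a translate, so the
    double integral of the absolute value factors. *)
Lemma integrable_conv_fun : (mu \x mu)%E.-integrable setT (EFin \o conv_fun).
Proof.
apply/integrable21ltyP; first by apply/measurable_EFinP; exact: measurable_conv_fun.
have mg : measurable_fun setT (fun x => `|g x|%:E).
  by apply/measurable_EFinP; apply: measurableT_comp => //; apply/measurable_EFinP; exact: measurable_int gi.
rewrite (_ : (fun y => _) = fun y => `|f y|%:E * \int[mu]_x `|g x|%:E)%E; last first.
  apply/funext => y; under eq_integral do rewrite /conv_fun/= normrM EFinM.
  rewrite ge0_integralZl//=.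
    by rewrite (ge0_integral_shift y (f := fun x => `|g x|%:E)).
  exact: (measurableT_comp mg (measurable_fun_shift y)).
have Gfin : (\int[mu]_x `|g x|%:E)%E \is a fin_num.
  by have /integrableP[_] := gi; rewrite ge0_fin_numE// integral_ge0.
rewrite -(fineK Gfin) ge0_integralZr//=.
- rewrite lte_mul_pinfty ?integral_ge0//.
  + rewrite ge0_fin_numE ?integral_ge0//. by have /integrableP[_] := fi.
  + by rewrite ltry.
- by apply/measurable_EFinP; apply: measurableT_comp => //; apply/measurable_EFinP; exact: measurable_int fi.
- by rewrite lee_fin fine_ge0// integral_ge0.
Qed.

Lemma integral_conv_fun : (\int[mu \x mu]_z (conv_fun z)%:E =
  (\int[mu]_x f x * \int[mu]_x g x)%R%:E)%E.
Proof.
rewrite -(integral21_prod_meas1 integrable_conv_fun) /fubini_G.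
have Gfin := integrable_fin_num measurableT gi.
have Ffin := integrable_fin_num measurableT fi.
under eq_integral => y _.
  under eq_integral do rewrite /= /conv_fun/= EFinM.
  rewrite integralZl//; last exact: (integrable_shift y gi).
  rewrite (integral_shift y gi) -(fineK Gfin).
  over.
by rewrite integralZr// EFinM /Rintegral !fineK.
Qed.

End RealConvolution.

Section ComplexParts.
Variable R : realType.
Implicit Types z w : R[i].

Lemma Re_mul z w : complex.Re (z * w) =
  complex.Re z * complex.Re w - complex.Im z * complex.Im w.
Proof. by case: z; case: w. Qed.

Lemma Im_mul z w : complex.Im (z * w) =
  complex.Re z * complex.Im w + complex.Im z * complex.Re w.
Proof. by case: z; case: w. Qed.

Lemma Re_add z w : complex.Re (z + w) = complex.Re z + complex.Re w.
Proof. by case: z; case: w. Qed.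

Lemma Im_add z w : complex.Im (z + w) = complex.Im z + complex.Im w.
Proof. by case: z; case: w. Qed.

Lemma Re_inv z : complex.Re z^-1 =
  complex.Re z * (complex.Re z ^+ 2 + complex.Im z ^+ 2)^-1.
Proof. by case: z. Qed.

Lemma Im_inv z : complex.Im z^-1 =
  - complex.Im z * (complex.Re z ^+ 2 + complex.Im z ^+ 2)^-1.
Proof. by case: z => a b /=; rewrite mulNr. Qed.

Lemma complex_ext z w : complex.Re z = complex.Re w ->
  complex.Im z = complex.Im w -> z = w.
Proof. by case: z => a b; case: w => c d /= -> ->. Qed.

End ComplexParts.

Section ComplexConvolution.
Variable R : realType.
Local Notation C := R[i].
Local Notation mR := (measurableTypeR R).
Local Notation mu := (@lebesgue_measure R).
Implicit Types (F G k : R -> C).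

(** The values are nonnegative, so that the inverse is the real power -1. *)
Lemma measurable_inv (d : measure_display) (T : measurableType d) (f : T -> R) :
  measurable_fun setT f -> (forall x, 0 <= f x) ->
  measurable_fun setT (fun x => (f x)^-1).
Proof.
move=> mf f0; rewrite (_ : (fun x => _) = fun x => f x `^ (-1)).
  exact: (measurableT_comp (measurable_powR (-1)) mf).
by apply/funext => x; rewrite powR_inv1.
Qed.

Lemma measurablecM F G : measurablec F -> measurablec G ->
  measurablec (fun x => F x * G x).
Proof.
move=> [f1 f2] [g1 g2]; split.
- under eq_fun do rewrite Re_mul.
  by apply: measurable_funB; exact: measurable_funM.
- under eq_fun do rewrite Im_mul.
  by apply: measurable_funD; exact: measurable_funM.
Qed.

Lemma measurablec_inv k : measurablec k -> measurablec (fun x => (k x)^-1).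
Proof.
move=> [m1 m2].
have mi : measurable_fun [set: R]
    (fun x => (complex.Re (k x) ^+ 2 + complex.Im (k x) ^+ 2)^-1).
  apply: measurable_inv; last by move=> x; rewrite addr_ge0// sqr_ge0.
  by apply: measurable_funD; exact: measurable_funX.
split.
- under eq_fun do rewrite Re_inv; exact: measurable_funM.
- under eq_fun do rewrite Im_inv; apply: measurable_funM => //.
  exact: measurableT_comp.
Qed.

Lemma ae_imply (P Q : R -> Prop) : (forall x, P x -> Q x) ->
  {ae mu, forall x, P x} -> {ae mu, forall x, Q x}.
Proof. by move=> PQ; apply: (@filterS _ _ (ae_filter_ringOfSetsType _)). Qed.

Lemma ae_imply2 (P Q S : R -> Prop) : (forall x, P x -> Q x -> S x) ->
  {ae mu, forall x, P x} -> {ae mu, forall x, Q x} -> {ae mu, forall x, S x}.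
Proof. by move=> PQ; apply: (@filterS2 _ _ (ae_filter_ringOfSetsType _)). Qed.

Lemma integrablecMr F (c : C) : integrablec F -> integrablec (fun t => F t * c).
Proof.
move=> [i1 i2]; split.
- rewrite (_ : (fun x => _) = (fun x => (complex.Re c)%:E * (complex.Re (F x))%:E)
    \- (fun x => (complex.Im c)%:E * (complex.Im (F x))%:E))%E.
    by apply: integrableB => //; exact: integrableZl.
  by apply/funext => x; rewrite Re_mul -!EFinM -EFinB ![_ * complex.Re c]mulrC ![_ * complex.Im c]mulrC.
- rewrite (_ : (fun x => _) = (fun x => (complex.Im c)%:E * (complex.Re (F x))%:E)
    \+ (fun x => (complex.Re c)%:E * (complex.Im (F x))%:E))%E.
    by apply: integrableD => //; exact: integrableZl.
  by apply/funext => x; rewrite Im_mul -!EFinM -EFinD ![_ * complex.Re c]mulrC ![_ * complex.Im c]mulrC.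
Qed.

Lemma integralcMr F (c : C) : integrablec F ->
  integralc (fun t => F t * c) = integralc F * c.
Proof.
move=> [i1 i2].
have Z1 (a : R) : \int[mu]_x (complex.Re (F x) * a) = (\int[mu]_x complex.Re (F x)) * a.
  exact: RintegralZr.
have Z2 (a : R) : \int[mu]_x (complex.Im (F x) * a) = (\int[mu]_x complex.Im (F x)) * a.
  exact: RintegralZr.
have I1 (a : R) : mu.-integrable setT (fun x => (complex.Re (F x) * a)%:E).
  rewrite (_ : (fun x => _) = (fun x => a%:E * (complex.Re (F x))%:E)%E).
    exact: integrableZl.
  by apply/funext => x; rewrite -EFinM mulrC.
have I2 (a : R) : mu.-integrable setT (fun x => (complex.Im (F x) * a)%:E).
  rewrite (_ : (fun x => _) = (fun x => a%:E * (complex.Im (F x))%:E)%E).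
    exact: integrableZl.
  by apply/funext => x; rewrite -EFinM mulrC.
apply: complex_ext.
- rewrite /integralc Re_mul/=; under eq_Rintegral do rewrite Re_mul.
  rewrite RintegralB//; [by rewrite Z1 Z2|exact: I1|exact: I2].
- rewrite /integralc Im_mul/=; under eq_Rintegral do rewrite Im_mul.
  rewrite RintegralD//; [by rewrite Z1 Z2|exact: I1|exact: I2].
Qed.

(** The positive and negative parts are treated separately by Tonelli's
    theorem, because the convolution integrand may fail to be integrable for a
    null set of [x], on which measurability is needed all the same. *)
Lemma measurable_Rintegral_section (h : mR * mR -> R) :
  measurable_fun setT h -> measurable_fun setT (fun x => \int[mu]_t h (x, t)).
Proof.
move=> mh; apply: measurableT_comp; first exact: fine_measurable.
have mH : measurable_fun setT (EFin \o h) by exact/measurable_EFinP.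
rewrite (_ : (fun x => _) = (fun x => \int[mu]_t (EFin \o h)^\+ (x, t)) \-
    (fun x => \int[mu]_t (EFin \o h)^\- (x, t)))%E.
  apply: emeasurable_funB; apply: (@measurable_fun_fubini_tonelli_F _ _ _ _ _ mu) => //.
  + exact: measurable_funepos.
  + exact: measurable_funeneg.
apply/funext => x; rewrite [LHS]integralE.
under eq_integral do rewrite (funepos_comp (EFin \o h) (pair x))/=.
by under [X in (_ - X)%E = _]eq_integral do rewrite (funeneg_comp (EFin \o h) (pair x))/=.
Qed.

(** Lebesgue measure lives here on the Borel sets, where it is not complete, so
    the measurability of [f] does not follow from that of [g]. *)
Lemma ae_eq_integrable (f g : mR -> R) : measurable_fun setT f ->
  mu.-integrable setT (EFin \o g) -> {ae mu, forall x, f x = g x} ->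
  mu.-integrable setT (EFin \o f) /\ \int[mu]_x f x = \int[mu]_x g x.
Proof.
move=> mf gi fg.
have mF : measurable_fun setT (EFin \o f) by exact/measurable_EFinP.
have mG : measurable_fun setT (EFin \o g) by exact: measurable_int gi.
split.
- apply/integrableP; split=> //; have /integrableP[_] := gi.
  rewrite (@ae_eq_integral _ _ _ mu setT (abse \o (EFin \o f)) (abse \o (EFin \o g)))//.
  + exact: measurableT_comp.
  + exact: measurableT_comp.
  + by apply: filterS fg => x /= -> _.
- congr fine; apply: ae_eq_integral => //.
  by apply: filterS fg => x /= -> _.
Qed.

Lemma fubini_Rintegral (h : mR * mR -> R) :
  (mu \x mu)%E.-integrable setT (EFin \o h) ->
  mu.-integrable setT (fun x => (\int[mu]_t h (x, t))%:E) /\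
  \int[mu]_x (\int[mu]_t h (x, t)) = \int[(mu \x mu)%E]_z h z.
Proof.
move=> hi.
have S := integrable_fubini_F hi.
have mh : measurable_fun setT h by apply/measurable_EFinP; exact: measurable_int hi.
have mS := measurable_Rintegral_section mh.
have E : ae_eq mu setT (fun x => (\int[mu]_t h (x, t))%:E) (fubini_F mu (EFin \o h)).
  apply: filterS (ae_integrable1 hi) => x hx _.
  by rewrite /Rintegral fineK//; exact: integrable_fin_num.
have mS' : measurable_fun setT (fun x => (\int[mu]_t h (x, t))%:E) by exact/measurable_EFinP.
have mF := measurable_int _ S.
split.
- apply/integrableP; split=> //; have /integrableP[_] := S.
  rewrite (@ae_eq_integral _ _ _ mu setT (abse \o fubini_F mu (EFin \o h))
     (fun x => `|(\int[mu]_t h (x, t))%:E|%E))//.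
  + exact: measurableT_comp.
  + exact: measurableT_comp.
  + by apply: filterS E => x Ex _; exact: (congr1 abse (Ex Logic.I)).
- by rewrite [LHS]/Rintegral (ae_eq_integral _ _ measurableT mS' mF E) (integral12_prod_meas1 hi).
Qed.

Section Weighted.
Variables F G k : R -> C.
Hypotheses (Fi : integrablec F) (Gi : integrablec G).
Hypotheses (mk : measurablec k) (k0 : {ae mu, forall x, k x != 0}).

Let P (z : mR * mR) : C := F z.2 * G (z.1 - z.2).

Let Re_P z : complex.Re (P z) =
  conv_fun (fun x => complex.Re (F x)) (fun x => complex.Re (G x)) z -
  conv_fun (fun x => complex.Im (F x)) (fun x => complex.Im (G x)) z.
Proof. exact: Re_mul. Qed.

Let Im_P z : complex.Im (P z) =
  conv_fun (fun x => complex.Re (F x)) (fun x => complex.Im (G x)) z +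
  conv_fun (fun x => complex.Im (F x)) (fun x => complex.Re (G x)) z.
Proof. exact: Im_mul. Qed.

Let ReP_int : (mu \x mu)%E.-integrable setT (fun z => (complex.Re (P z))%:E).
Proof.
under eq_fun do rewrite Re_P EFinB.
by apply: integrableB => //; apply: integrable_conv_fun; move: Fi Gi => [? ?] [? ?].
Qed.

Let ImP_int : (mu \x mu)%E.-integrable setT (fun z => (complex.Im (P z))%:E).
Proof.
under eq_fun do rewrite Im_P EFinD.
by apply: integrableD => //; apply: integrable_conv_fun; move: Fi Gi => [? ?] [? ?].
Qed.

Let integral_P : \int[(mu \x mu)%E]_z complex.Re (P z) +i*
  \int[(mu \x mu)%E]_z complex.Im (P z) = integralc F * integralc G.
Proof.
have [F1 F2] := Fi; have [G1 G2] := Gi.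
have cE (f g : mR -> R) : mu.-integrable setT (EFin \o f) ->
    mu.-integrable setT (EFin \o g) ->
    \int[(mu \x mu)%E]_z conv_fun f g z = \int[mu]_x f x * \int[mu]_x g x.
  by move=> fi gi; rewrite /Rintegral integral_conv_fun.
apply: complex_ext => /=.
- under eq_Rintegral do rewrite Re_P.
  by rewrite RintegralB//; [rewrite !cE// Re_mul|exact: integrable_conv_fun..].
- under eq_Rintegral do rewrite Im_P.
  by rewrite RintegralD//; [rewrite !cE// Im_mul|exact: integrable_conv_fun..].
Qed.

Let conv_k x := integralc (fun t => F t * G (x - t) * (k x)^-1).

Let section_integrable : {ae mu, forall x, integrablec (fun t => F t * G (x - t))}.
Proof.
by apply: filterS2 (ae_integrable1 ReP_int) (ae_integrable1 ImP_int) => x.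
Qed.

Lemma ae_integrablec_weighted :
  {ae mu, forall x, integrablec (fun t => F t * G (x - t) * (k x)^-1)}.
Proof. by apply: ae_imply section_integrable => x; exact: integrablecMr. Qed.

Let mP1 : measurable_fun setT (fun z => complex.Re (P z)).
Proof. by apply/measurable_EFinP; exact: measurable_int ReP_int. Qed.
Let mP2 : measurable_fun setT (fun z => complex.Im (P z)).
Proof. by apply/measurable_EFinP; exact: measurable_int ImP_int. Qed.

Let measurable_conv_k : measurablec conv_k.
Proof.
have [m1 m2] := measurablec_inv mk.
have M1 : measurable_fun [set: mR * mR] (fun z => complex.Re (k z.1)^-1).
  exact: (measurableT_comp m1).
have M2 : measurable_fun [set: mR * mR] (fun z => complex.Im (k z.1)^-1).
  exact: (measurableT_comp m2).
split.
- apply: (@measurable_Rintegral_section (fun z => complex.Re (P z * (k z.1)^-1))).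
  under eq_fun do rewrite Re_mul.
  by apply: measurable_funB; exact: measurable_funM.
- apply: (@measurable_Rintegral_section (fun z => complex.Im (P z * (k z.1)^-1))).
  under eq_fun do rewrite Im_mul.
  by apply: measurable_funD; exact: measurable_funM.
Qed.

Let conv_kE : {ae mu, forall x, conv_k x * k x = integralc (fun t => F t * G (x - t))}.
Proof.
apply: ae_imply2 section_integrable k0 => x xi kx.
by rewrite /conv_k integralcMr// mulfVK.
Qed.

Let measurable_conv_kM : measurablec (fun x => conv_k x * k x).
Proof. exact: measurablecM. Qed.

(** Dividing the convolution of [F] and [G] at [x] by [k x] and multiplying by
    [k x] again changes nothing almost everywhere. *)
Lemma weighted_convolution :
  integrablec (fun x => conv_k x * k x) /\
  integralc (fun x => conv_k x * k x) = integralc F * integralc G.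
Proof.
have [S1 E1] := fubini_Rintegral ReP_int.
have [S2 E2] := fubini_Rintegral ImP_int.
have [m1 m2] := measurable_conv_kM.
have [I1 J1] : mu.-integrable setT (fun x => (complex.Re (conv_k x * k x))%:E) /\
    \int[mu]_x (complex.Re (conv_k x * k x)) = \int[mu]_x (\int[mu]_t complex.Re (P (x, t))).
  by apply: ae_eq_integrable => //; apply: ae_imply conv_kE => x ->.
have [I2 J2] : mu.-integrable setT (fun x => (complex.Im (conv_k x * k x))%:E) /\
    \int[mu]_x (complex.Im (conv_k x * k x)) = \int[mu]_x (\int[mu]_t complex.Im (P (x, t))).
  by apply: ae_eq_integrable => //; apply: ae_imply conv_kE => x ->.
by split=> //; rewrite -integral_P /integralc J1 J2 E1 E2.
Qed.

End Weighted.
End ComplexConvolution.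

(** * Complex-valued functions of a real variable *)

Section ComplexFunctions.
Variable R : realType.
Local Notation C := R[i].
Implicit Types (f g : R -> C) (x : R).

Definition analyticc f :=
  analytic (fun x => complex.Re (f x)) /\ analytic (fun x => complex.Im (f x)).

Definition is_derivec f x (l : C) :=
  is_derive x 1 (fun y => complex.Re (f y)) (complex.Re l) /\
  is_derive x 1 (fun y => complex.Im (f y)) (complex.Im l).

Definition contc f x :=
  continuous_at x (fun y => complex.Re (f y)) /\
  continuous_at x (fun y => complex.Im (f y)).

Lemma analyticN (f : R -> R) : analytic f -> analytic (fun x => - f x).
Proof.
move=> af; rewrite (_ : (fun x => _) = fun x => -1 * f x).
  by apply: analyticM => //; exact: analytic_cst.
by apply/funext => x; rewrite mulN1r.
Qed.

Lemma analyticc_cst (c : C) : analyticc (fun=> c).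
Proof. by split; exact: analytic_cst. Qed.

Lemma analyticc_real (f : R -> R) : analytic f -> analyticc (fun x => (f x)%:C).
Proof. by move=> af; split=> //=; exact: analytic_cst. Qed.

Lemma analyticcD f g : analyticc f -> analyticc g -> analyticc (fun x => f x + g x).
Proof.
move=> [f1 f2] [g1 g2]; split.
- under eq_fun do rewrite Re_add; exact: analyticD.
- under eq_fun do rewrite Im_add; exact: analyticD.
Qed.

Lemma analyticcM f g : analyticc f -> analyticc g -> analyticc (fun x => f x * g x).
Proof.
move=> [f1 f2] [g1 g2]; split.
- under eq_fun do rewrite Re_mul.
  by apply: analyticD; [|apply: analyticN]; exact: analyticM.
- under eq_fun do rewrite Im_mul; apply: analyticD; exact: analyticM.
Qed.

Lemma analyticc_derive f : analyticc f ->
  exists2 f', analyticc f' & forall x, `|x| < 1 -> is_derivec f x (f' x).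
Proof.
move=> [/analytic_derive[d1 a1 H1] /analytic_derive[d2 a2 H2]].
exists (fun x => d1 x +i* d2 x); first by split.
by move=> x x1; split=> /=; [exact: H1|exact: H2].
Qed.

(** A zero is a common zero of both parts, and one of them is nonzero at 0. *)
Lemma countable_zerosc f : analyticc f -> f 0 != 0 ->
  countable [set x | `|x| < 1 /\ f x = 0].
Proof.
move=> [a1 a2] f0.
have [re0|re0] := eqVneq (complex.Re (f 0)) 0; last first.
  apply: sub_countable (countable_zeros a1 re0).
  by apply: subset_card_le => x [x1 /= ->].
have im0 : complex.Im (f 0) != 0.
  by apply: contra_neq f0 => im0; exact: complex_ext.
apply: sub_countable (countable_zeros a2 im0).
by apply: subset_card_le => x [x1 /= ->].
Qed.

Lemma is_derivec_derivec f g x l : {near x, f =1 g} -> is_derivec g x l ->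
  derivec f x = l.
Proof.
move=> fg [g1 g2].
have h1 : is_derive x 1 (fun y => complex.Re (f y)) (complex.Re l).
  by apply: near_eq_is_derive g1; apply: filterS fg => y ->.
have h2 : is_derive x 1 (fun y => complex.Im (f y)) (complex.Im l).
  by apply: near_eq_is_derive g2; apply: filterS fg => y ->.
apply: complex_ext; rewrite /derivec/= derive1E.
- by have [_ <-] := h1.
- by have [_ <-] := h2.
Qed.

Lemma is_derivec_cst (c : C) x : is_derivec (fun=> c) x 0.
Proof. by split; exact: is_derive_cst. Qed.

Lemma is_derivec_mul f g x l m : is_derivec f x l -> is_derivec g x m ->
  is_derivec (fun y => f y * g y) x (l * g x + f x * m).
Proof.
move=> [f1 f2] [g1 g2]; split.
- under eq_fun do rewrite Re_mul.
  apply: (is_derive_eq (is_derive_addf (is_derive_mulf f1 g1) (is_derive_oppf (is_derive_mulf f2 g2)))).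
  by rewrite Re_add !Re_mul; ring.
- under eq_fun do rewrite Im_mul.
  apply: (is_derive_eq (is_derive_addf (is_derive_mulf f1 g2) (is_derive_mulf f2 g1))).
  by rewrite Im_add !Im_mul; ring.
Qed.

Lemma is_derivec_comp f (v : R -> R) x l (d : R) : is_derivec f (v x) l ->
  is_derive x 1 v d -> is_derivec (fun y => f (v y)) x (l * d%:C).
Proof.
move=> [f1 f2] dv; split.
- apply: (is_derive_eq (is_derive1_comp (g := v) f1 dv)).
  by rewrite Re_mul/= mulr0 subr0.
- apply: (is_derive_eq (is_derive1_comp (g := v) f2 dv)).
  by rewrite Im_mul/= mulr0 add0r.
Qed.

Lemma is_derivec_real (v : R -> R) x d : is_derive x 1 v d ->
  is_derivec (fun y => (v y)%:C) x d%:C.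
Proof. by move=> dv; split=> //=; exact: is_derive_cst. Qed.

Lemma is_derivec_expc f x l : is_derivec f x l ->
  is_derivec (fun y => expc (f y)) x (expc (f x) * l).
Proof.
move=> [f1 f2].
have e1 := is_derive1_comp (g := fun y => complex.Re (f y)) (is_derive_expR _) f1.
have c1 := is_derive1_comp (g := fun y => complex.Im (f y)) (is_derive_cos _) f2.
have s1 := is_derive1_comp (g := fun y => complex.Im (f y)) (is_derive_sin _) f2.
split.
- apply: (is_derive_eq (is_derive_mulf e1 c1)).
  by rewrite Re_mul/=; ring.
- apply: (is_derive_eq (is_derive_mulf e1 s1)).
  by rewrite Im_mul/=; ring.
Qed.

Lemma expc_neq0 (z : C) : expc z != 0.
Proof.
apply/eqP => /(congr1 (fun w => (complex.Re w, complex.Im w))) [].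
rewrite /expc/= => /eqP; rewrite mulf_eq0 gt_eqF ?expR_gt0//= => /eqP c0 /eqP.
rewrite mulf_eq0 gt_eqF ?expR_gt0//= => /eqP s0.
by have /eqP := cos2Dsin2 (complex.Im z); rewrite c0 s0 !expr0n/= addr0 eq_sym oner_eq0.
Qed.

Lemma derivable_cont (v : R -> R) x d : is_derive x 1 v d -> continuous_at x v.
Proof. by move=> [dv _]; exact/differentiable_continuous/derivable1_diffP. Qed.

Lemma is_derivec_contc f x l : is_derivec f x l -> contc f x.
Proof. by move=> [f1 f2]; split; [exact: derivable_cont f1|exact: derivable_cont f2]. Qed.

Lemma contc_cst (c : C) x : contc (fun=> c) x.
Proof. by split; exact: cvg_cst. Qed.

Lemma contc_real (v : R -> R) x : continuous_at x v -> contc (fun y => (v y)%:C) x.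
Proof. by move=> cv; split=> //=; exact: cvg_cst. Qed.

Lemma contcD f g x : contc f x -> contc g x -> contc (fun y => f y + g y) x.
Proof.
move=> [f1 f2] [g1 g2]; split.
- under eq_fun do rewrite Re_add; exact: cvgD.
- under eq_fun do rewrite Im_add; exact: cvgD.
Qed.

Lemma contcM f g x : contc f x -> contc g x -> contc (fun y => f y * g y) x.
Proof.
move=> [f1 f2] [g1 g2]; split.
- under eq_fun do rewrite Re_mul.
  by apply: (@cvgB _ R^o); exact: cvgM.
- under eq_fun do rewrite Im_mul.
  by apply: (@cvgD _ R^o); exact: cvgM.
Qed.

Lemma contc_comp f (v : R -> R) x : contc f (v x) -> continuous_at x v ->
  contc (fun y => f (v y)) x.
Proof.
by move=> [f1 f2] cv; split; [exact: (continuous_comp cv f1)|exact: (continuous_comp cv f2)].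
Qed.

Lemma contc_expc f x : contc f x -> contc (fun y => expc (f y)) x.
Proof.
move=> [f1 f2]; split; rewrite /expc/=; apply: cvgM.
- exact: (continuous_comp f1 (@continuous_expR R _)).
- exact: (continuous_comp f2 (@continuous_cos R _)).
- exact: (continuous_comp f1 (@continuous_expR R _)).
- exact: (continuous_comp f2 (@continuous_sin R _)).
Qed.

Lemma near_eq_contc f g x : {near x, f =1 g} -> contc g x -> contc f x.
Proof.
move=> fg [g1 g2]; split.
- rewrite /continuous_at (nbhs_singleton fg).
  apply: cvg_trans g1; apply: near_eq_cvg; apply: filterS fg => y -> //.
- rewrite /continuous_at (nbhs_singleton fg).
  apply: cvg_trans g2; apply: near_eq_cvg; apply: filterS fg => y -> //.
Qed.

End ComplexFunctions.

(** * The Gauss hypergeometric series *)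

Section GaussSeries.
Variable R : realType.
Local Notation C := R[i].
Local Notation normc := ComplexField.Normc.normc.

(** Ratio test: for [s < 1] the sequence [w n * s ^ n] is eventually
    nonincreasing, since the quotient of the two quadratic polynomials in [n]
    tends to 1. *)
Lemma unit_radius_ratio (w : nat -> R) (A B c : R) :
  0 <= A -> 0 <= B -> 0 <= c -> (forall n, 0 <= w n) ->
  (forall n, (c + n%:R) * n.+1%:R * w n.+1 <= (A + n%:R) * (B + n%:R) * w n) ->
  unit_radius w.
Proof.
move=> A0 B0 c0 w0 Hw s s0 s1.
(* n >= N makes (1 - s) n >= A + B + A B, hence (A + n) (B + n) s <= n^2 + n *)
pose N := (Num.bound ((A + B + A * B) / (1 - s))).+1.
have s1' : 0 < 1 - s by rewrite subr_gt0.
have NP n : (N <= n)%N -> (A + n%:R) * (B + n%:R) * s <= (c + n%:R) * n.+1%:R.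
  move=> Nn.
  have n1 : 1 <= n%:R :> R by rewrite ler1n (leq_trans _ Nn).
  have nN : (A + B + A * B) <= (1 - s) * n%:R.
    rewrite [leRHS]mulrC -ler_pdivrMr//; apply: ltW; apply: lt_le_trans (archi_boundP _) _.
      by rewrite divr_ge0 ?(ltW s1')// addr_ge0 ?mulr_ge0// addr_ge0.
    by rewrite ler_nat ltnW.
  rewrite -natr1; move: n1 nN; move: (n%:R : R) => m m1 mN.
  have h1 : A * B <= A * B * m by rewrite ler_peMr// mulr_ge0.
  have h2 : (A + B + A * B) * m <= (1 - s) * m * m by rewrite ler_wpM2r//; lra.
  have h3 : 0 <= c * (m + 1) by rewrite mulr_ge0//; lra.
  have h4 : (A * B + (A + B) * m) * s <= A * B + (A + B) * m.
    by rewrite ler_piMr ?(ltW s1)// addr_ge0// mulr_ge0// ?addr_ge0//; lra.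
  have -> : (A + m) * (B + m) * s = (A * B + (A + B) * m) * s + m * m * s by ring.
  have -> : (c + m) * (m + 1) = c * (m + 1) + m * m + m by ring.
  nra.
exists (\sum_(i < N.+1) w i * s ^+ i) => n; rewrite ger0_norm//.
have [nN|nN] := leqP n N.
  rewrite (bigD1 (Ordinal (nN : (n < N.+1)%N)))//= lerDl sumr_ge0// => i _.
  by rewrite mulr_ge0// exprn_ge0// ltW.
have [k ->] : exists k, n = (N + k)%N by exists (n - N)%N; rewrite subnKC// ltnW.
elim: k => [|k IH].
  rewrite addn0 big_ord_recr/= lerDr sumr_ge0// => i _.
  by rewrite mulr_ge0// exprn_ge0// ltW.
apply: le_trans IH; rewrite addnS exprS mulrA ler_wpM2r//.
  by rewrite exprn_ge0// ltW.
have Nk : 1 <= (N + k)%:R :> R by rewrite ler1n.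
have d0 : 0 < (c + (N + k)%:R) * (N + k).+1%:R.
  by rewrite mulr_gt0// ltr_wpDl// (lt_le_trans ltr01).
rewrite -(ler_pM2l d0) mulrA (le_trans (ler_wpM2r (ltW s0) (Hw _)))//.
by rewrite mulrAC ler_wpM2r// NP// leq_addr.
Qed.

Lemma normc_Re (z : C) : `|complex.Re z| <= normc z.
Proof.
case: z => a b /=; rewrite -sqrtr_sqr ler_wsqrtr// lerDl; exact: sqr_ge0.
Qed.

Lemma normc_Im (z : C) : `|complex.Im z| <= normc z.
Proof.
case: z => a b /=; rewrite -sqrtr_sqr ler_wsqrtr// lerDr; exact: sqr_ge0.
Qed.

Lemma normc_ge0 (z : C) : 0 <= normc z.
Proof. by case: z => a b; exact: sqrtr_ge0. Qed.

Lemma normc_real (x : R) : 0 <= x -> normc x%:C = x.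
Proof. by move=> x0; rewrite /= expr0n/= addr0 sqrtr_sqr ger0_norm. Qed.

Definition gauss_coef (a b c : C) n : C :=
  pochhammer a n * pochhammer b n / (pochhammer c n * (n`!)%:R).

Lemma natC n : (n%:R : C) = (n%:R : R)%:C.
Proof. by rewrite rmorph_nat. Qed.

Lemma gauss_coefS (a b : C) (c : R) n : 0 < c ->
  gauss_coef a b c%:C n.+1 * ((c + n%:R) * n.+1%:R)%:C =
  gauss_coef a b c%:C n * ((a + n%:R) * (b + n%:R)).
Proof.
move=> c0.
have cn m : (c%:C + m%:R : C) != 0.
  by rewrite natC -rmorphD/= fmorph_eq0 gt_eqF// ltr_pwDl.
have pc m : pochhammer c%:C m != 0 by apply/prodf_neq0 => i _.
have fn m : (m`!%:R : C) != 0 by rewrite pnatr_eq0 -lt0n fact_gt0.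
rewrite /gauss_coef factS natrM /pochhammer !big_ord_recr/=.
rewrite -/(pochhammer a n) -/(pochhammer b n) -/(pochhammer c%:C n).
rewrite rmorphM rmorphD/= -!natC.
have n1 : (n.+1%:R : C) != 0 by rewrite pnatr_eq0.
field.
by rewrite pc fn cn nat1r n1.
Qed.

Lemma unit_radius_gauss (a b : C) (c : R) : 0 < c ->
  unit_radius (fun n => normc (gauss_coef a b c%:C n)).
Proof.
move=> c0; apply: (@unit_radius_ratio _ (normc a) (normc b) c).
- exact: normc_ge0.
- exact: normc_ge0.
- exact: ltW.
- by move=> n; exact: normc_ge0.
- move=> n; have cn0 : 0 <= (c + n%:R) * n.+1%:R.
    by rewrite mulr_ge0// addr_ge0// ltW.
  rewrite -{1}(normc_real cn0) mulrC -ComplexField.Normc.normcM gauss_coefS//.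
  rewrite !ComplexField.Normc.normcM [leLHS]mulrC.
  apply: ler_wpM2r; first by rewrite !mulr_ge0 ?normc_ge0.
  have nn (z : C) : normc (z + n%:R) <= normc z + n%:R.
    by rewrite (le_trans (le_normcD _ _))// lerD2l natC normc_real.
  by apply: ler_pM => //; exact: normc_ge0.
Qed.

Lemma analyticc_gauss_series (a b : C) (c : R) : 0 < c ->
  analyticc (gauss_series a b c%:C) /\ gauss_series a b c%:C 0 = 1.
Proof.
move=> c0; pose q := gauss_coef a b c%:C.
have qE z : gauss_series a b c%:C z =
    limn (pseries (fun n => complex.Re (q n)) z) +i*
    limn (pseries (fun n => complex.Im (q n)) z).
  have zE n : (z%:C : C) ^+ n = (z ^+ n)%:C by rewrite rmorphXn.
  rewrite /gauss_series /seriesc /pseries.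
  congr (limn (series _) +i* limn (series _)); apply/funext => n.
  - by rewrite zE Re_mul [complex.Im _%:C]/= mulr0 subr0.
  - by rewrite zE Im_mul [complex.Im _%:C]/= mulr0 add0r.
have hu (f : C -> R) : (forall z, `|f z| <= normc z) -> unit_radius (fun n => f (q n)).
  move=> fz s s0 s1; have [K HK] := unit_radius_gauss a b c0 s0 s1.
  exists K => n; apply: le_trans (HK n); rewrite ler_wpM2r ?exprn_ge0 ?(ltW s0)//.
  by rewrite [leRHS]ger0_norm ?normc_ge0.
split.
  split; under eq_fun do rewrite qE/=; apply: analytic_pseries; apply: hu.
  - exact: normc_Re.
  - exact: normc_Im.
have q0 : q 0%N = 1.
  by rewrite /q /gauss_coef /pochhammer !big_ord0 fact0 mulr1n !mulr1 invr1 mulr1.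
by rewrite qE !pseries0 q0.
Qed.

End GaussSeries.

(** * Zeros of the Jacobi-Dunkl kernel in a local chart *)

Section Chart.
Variable R : realType.
Local Notation C := R[i].
Local Notation i_C := (0 +i* 1 : C).

(** The common shape of [phi] in the two regions: a factor [E] with logarithmic
    derivative [tau * e0] times [F (v x)], where the derivative of [v] is
    [tau * m v].  In both regions [tau] is odd in [x] while [v] is even, so that
    [tau] is not a function of [v]; its square is, namely [kappa v]. *)
Record chart (phi : R -> C) (U : set R) (F E : R -> C) (v tau : R -> R)
    (e0 : C) (m kappa : R -> R) : Prop := Chart {
  chart_open : open U;
  chart_analytic : analyticc F;
  chart_F0 : F 0 = 1;
  chart_m : analytic m;
  chart_kappa : analytic kappa;
  chart_kappa0 : kappa 0 = 0;
  chart_v1 : forall x, U x -> `|v x| < 1;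
  chart_phi : forall x, U x -> phi x = E x * F (v x);
  chart_E0 : forall x, U x -> E x != 0;
  chart_dE : forall x, U x -> is_derivec E x (E x * ((tau x)%:C * e0));
  chart_dv : forall x, U x -> is_derive x 1 v (tau x * m (v x));
  chart_tau : forall x, U x -> continuous_at x tau;
  chart_tau2 : forall x, U x -> tau x ^+ 2 = kappa (v x) }.

Variables (phi : R -> C) (U : set R) (F E : R -> C) (v tau : R -> R)
  (e0 : C) (m kappa : R -> R).
Hypothesis ch : chart phi U F E v tau e0 m kappa.
Variable l : C.

Let psi x := phi x - i_C / l * derivec phi x.

Lemma psi_chart : exists2 F' : R -> C, analyticc F' &
  forall x, U x -> contc (fun y => F' (v y)) x /\
    psi x = E x * (F (v x) - i_C / l * ((tau x)%:C *
      (e0 * F (v x) + (m (v x))%:C * F' (v x)))).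
Proof.
have [F' aF' dF] := analyticc_derive (chart_analytic ch).
have [F2 _ dF'] := analyticc_derive aF'.
exists F' => // x Ux; split.
  apply: contc_comp (derivable_cont (chart_dv ch Ux)).
  exact: is_derivec_contc (dF' _ (chart_v1 ch Ux)).
have dphi : derivec phi x = E x * ((tau x)%:C * e0) * F (v x) +
    E x * (F' (v x) * (tau x * m (v x))%:C).
  apply: (@is_derivec_derivec _ _ (fun y => E y * F (v y))).
    by apply: filterS (open_nbhs_nbhs (conj (chart_open ch) Ux)) => y Uy; exact: (chart_phi ch Uy).
  apply: is_derivec_mul (chart_dE ch Ux) _.
  exact: is_derivec_comp (dF _ (chart_v1 ch Ux)) (chart_dv ch Ux).
by rewrite /psi (chart_phi ch Ux) dphi rmorphM/=; ring.
Qed.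

Lemma psi_contc x : U x -> contc psi x.
Proof.
move=> Ux; have [F' aF' H] := psi_chart.
apply: (@near_eq_contc _ _ (fun x => E x * (F (v x) + - (i_C / l) * ((tau x)%:C *
      (e0 * F (v x) + (m (v x))%:C * F' (v x)))))).
  apply: filterS (open_nbhs_nbhs (conj (chart_open ch) Ux)) => y Uy.
  by rewrite (H _ Uy).2 mulNr.
have cv := derivable_cont (chart_dv ch Ux).
have [F1 _ dF] := analyticc_derive (chart_analytic ch).
have cF : contc (fun y => F (v y)) x.
  by apply: contc_comp cv; exact: is_derivec_contc (dF _ (chart_v1 ch Ux)).
have cm : contc (fun y => (m (v y))%:C) x.
  apply: contc_real; apply: (continuous_comp cv).
  apply/differentiable_continuous/derivable1_diffP.
  exact: analytic_derivable (chart_m ch) (chart_v1 ch Ux).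
apply: contcM; first exact: is_derivec_contc (chart_dE ch Ux).
apply: contcD => //; apply: contcM; first exact: contc_cst.
apply: contcM; first exact: contc_real (chart_tau ch Ux).
apply: contcD; first by apply: contcM => //; exact: contc_cst.
by apply: contcM => //; exact: (H _ Ux).1.
Qed.

(** Squaring the equation [psi x = 0] eliminates [tau] and leaves the vanishing
    at [v x] of an analytic function whose value at 0 is [F 0 ^ 2 = 1]. *)
Lemma psi_zeros : exists Z, countable Z /\
  forall x, U x -> psi x = 0 -> Z (v x).
Proof.
have [F' aF' H] := psi_chart.
pose K y := F y * F y + l^-1 * l^-1 * ((kappa y)%:C *
  ((e0 * F y + (m y)%:C * F' y) * (e0 * F y + (m y)%:C * F' y))).
have aF := chart_analytic ch.
have aG : analyticc (fun y => e0 * F y + (m y)%:C * F' y).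
  apply: analyticcD; first by apply: analyticcM => //; exact: analyticc_cst.
  by apply: analyticcM => //; apply: analyticc_real; exact: chart_m ch.
exists [set y | `|y| < 1 /\ K y = 0]; split.
  apply: countable_zerosc.
    apply: analyticcD; first exact: analyticcM.
    apply: analyticcM; first exact: analyticc_cst.
    apply: analyticcM; first by apply: analyticc_real; exact: chart_kappa ch.
    exact: analyticcM.
  by rewrite /K (chart_kappa0 ch) (chart_F0 ch) mul0r mulr0 addr0 mulr1 oner_eq0.
move=> x Ux; rewrite (H _ Ux).2 => /eqP.
rewrite mulf_eq0 (negbTE (chart_E0 ch Ux)) /= subr_eq0 => /eqP Fv.
split; first by apply: (chart_v1 ch Ux).
have ii : i_C * i_C = -1 by apply: complex_ext => /=; ring.
rewrite /K -(chart_tau2 ch Ux) {1 2}Fv.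
set G := e0 * _ + _.
rewrite [X in X + _](_ : _ = (i_C * i_C) * (l^-1 * l^-1 * ((tau x)%:C * (tau x)%:C * (G * G)))); last by ring.
by rewrite ii mulN1r rmorphXn/= expr2 addNr.
Qed.

End Chart.

(** * Hyperbolic functions *)

Section Hyperbolic.
Variable R : realType.
Implicit Types x y : R.

Lemma is_derive_expRN x : is_derive x 1 (fun y => expR (- y)) (- expR (- x)).
Proof.
apply: (is_derive_eq (is_derive1_comp (g := fun y => - y) (is_derive_expR _)
  (is_derive_oppf (is_derive_id x 1)))).
by rewrite mulrN1.
Qed.

Lemma is_derive_sinh x : is_derive x 1 (@sinhR R) (coshR x).
Proof.
rewrite /sinhR (_ : (fun x => _) = fun y => 2^-1 * (expR y + - expR (- y))).
  apply: (is_derive_eq (is_derive_mulc 2^-1 (is_derive_addf (is_derive_expR x)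
    (is_derive_oppf (is_derive_expRN x))))).
  by rewrite opprK mulrC.
by apply/funext => y; rewrite mulrC.
Qed.

Lemma is_derive_cosh x : is_derive x 1 (@coshR R) (sinhR x).
Proof.
rewrite /coshR (_ : (fun x => _) = fun y => 2^-1 * (expR y + expR (- y))).
  apply: (is_derive_eq (is_derive_mulc 2^-1 (is_derive_addf (is_derive_expR x)
    (is_derive_expRN x)))).
  by rewrite mulrC.
by apply/funext => y; rewrite mulrC.
Qed.

Lemma cosh2 x : coshR x ^+ 2 = 1 + sinhR x ^+ 2.
Proof.
rewrite /coshR /sinhR; have := expRxMexpNx_1 x.
move: (expR x) (expR (- x)) => p q pq.
apply/eqP; rewrite -subr_eq0; apply/eqP.
transitivity (p * q - 1); last by rewrite pq subrr.
by field.
Qed.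

Lemma cosh_gt0 x : 0 < coshR x.
Proof. by rewrite divr_gt0// addr_gt0// expR_gt0. Qed.

Lemma sinhN x : sinhR (- x) = - sinhR x.
Proof. by rewrite /sinhR opprK -mulNr opprB. Qed.

Lemma sinh0 : sinhR 0 = 0 :> R.
Proof. by rewrite /sinhR oppr0 subrr mul0r. Qed.

Lemma ltr_sinh x y : x < y -> sinhR x < sinhR y.
Proof.
by move=> xy; rewrite ltr_pM2r ?invr_gt0// ltrD// ?ltrN2 ltr_expR ?ltrN2.
Qed.

Lemma sinh_gt0 x : 0 < x -> 0 < sinhR x.
Proof. by move=> /ltr_sinh; rewrite sinh0. Qed.

Lemma sinh2_inj x y : 0 <= x -> 0 <= y -> sinhR x ^+ 2 = sinhR y ^+ 2 -> x = y.
Proof.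
have s0 (z : R) : 0 <= z -> 0 <= sinhR z.
  by rewrite le_eqVlt => /predU1P[<-|z0]; [rewrite sinh0|apply: ltW; exact: sinh_gt0].
move=> x0 y0 /eqP; rewrite eqrXn2 ?s0// => /eqP xy.
by have [/ltr_sinh|/ltr_sinh|//] := ltgtP x y; rewrite xy ltxx.
Qed.

Lemma countable_setU (T : Type) (A B : set T) :
  countable A -> countable B -> countable (A `|` B).
Proof.
move=> cA cB; rewrite (_ : A `|` B = \bigcup_(b in [set: bool]) if b then A else B).
  by apply: bigcup_countable => // -[].
apply/seteqP; split=> [x [Ax|Bx]|x [[] _]]; [by exists true|by exists false|by left|by right].
Qed.

(** On [U] the value [v x] determines [sinh^2 x], through [h], and therefore [x]
    up to sign. *)
Lemma countable_preimage_sinh2 (v : R -> R) (h : R -> R) (U Z : set R) :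
  (forall x, U x -> h (v x) = sinhR x ^+ 2) -> countable Z ->
  countable [set x | U x /\ Z (v x)].
Proof.
move=> hv Zc.
pose P := [set x | 0 <= x /\ (h @` Z) (sinhR x ^+ 2)].
have Pc : countable P.
  have hZ : countable (h @` Z) by apply: sub_countable Zc; exact: card_image_le.
  have inj : {in P &, injective (fun x => sinhR x ^+ 2)}.
    by move=> x y /set_mem[x0 _] /set_mem[y0 _]; exact: sinh2_inj.
  apply: (@sub_countable _ _ P (h @` Z)) => //.
  have e := @inj_card_eq _ _ P (fun x => sinhR x ^+ 2) inj.
  by rewrite -(card_le_eql e); apply: subset_card_le => _ [x [_ ?] <-].
apply: (@sub_countable _ _ _ (P `|` -%R @` P)).
  apply: subset_card_le => x [Ux Zx].
  have hx : (h @` Z) (sinhR x ^+ 2) by exists (v x) => //; exact: hv.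
  have [x0|x0] := leP 0 x; first by left.
  right; exists (- x); rewrite ?opprK//; split; first by rewrite oppr_ge0 ltW.
  by rewrite sinhN sqrrN.
apply: countable_setU => //.
by apply: sub_countable Pc; exact: card_image_le.
Qed.

End Hyperbolic.

(** * The Jacobi function and its two charts *)

Section Kernel.
Variable R : realType.
Local Notation C := R[i].
Local Notation i_C := (0 +i* 1 : C).

Lemma cont_sinh (x : R) : continuous_at x (@sinhR R).
Proof. exact: derivable_cont (is_derive_sinh x). Qed.

Lemma cont_cosh (x : R) : continuous_at x (@coshR R).
Proof. exact: derivable_cont (is_derive_cosh x). Qed.

Lemma cont_sinh2 (x : R) : continuous_at x (fun x => sinhR x ^+ 2).
Proof.
apply: (@derivable_cont _ _ _ (coshR x * sinhR x + sinhR x * coshR x)).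
exact: is_derive_mulf (is_derive_sinh x) (is_derive_sinh x).
Qed.

Definition tanhR (x : R) := sinhR x / coshR x.

Lemma is_derive_tanh (x : R) : is_derive x 1 tanhR (1 - tanhR x ^+ 2).
Proof.
have ch := gt_eqF (cosh_gt0 x).
have dV := is_deriveV (negbT ch) (is_derive_cosh x).
apply: (is_derive_eq (is_derive_mulf (is_derive_sinh x) dV)).
rewrite /tanhR /GRing.scale/=; field; exact: negbT.
Qed.

Definition sinh2_lt1 : set R := [set x | sinhR x ^+ 2 < 1].
Definition sinh2_gt1 : set R := [set x | 1 < sinhR x ^+ 2].

Lemma open_sinh2_lt1 : open sinh2_lt1.
Proof.
apply: (@open_comp _ _ (fun x => sinhR x ^+ 2) [set y | y < 1]); last exact: open_lt.
by move=> x _; exact: cont_sinh2.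
Qed.

Lemma open_sinh2_gt1 : open sinh2_gt1.
Proof.
apply: (@open_comp _ _ (fun x => sinhR x ^+ 2) [set y | 1 < y]); last exact: open_gt.
by move=> x _; exact: cont_sinh2.
Qed.

Lemma countable_sinh2_eq1 : countable [set x : R | sinhR x ^+ 2 = 1].
Proof.
apply: (@sub_countable _ _ _ [set x : R | True /\ [set (1:R)] (sinhR x ^+ 2)]).
  by apply: subset_card_le => x /= ->.
apply: (@countable_preimage_sinh2 _ (fun x => sinhR x ^+ 2) id setT) => //.
Qed.

Variables (a b : C) (c : R).
Hypothesis c0 : 0 < c.
Let phi (x : R) := gauss_2F1 a b c%:C (- sinhR x ^+ 2).

(** Here [v = - sinh^2 x] has derivative [-2 tau] with [tau = sinh x cosh x] and
    [tau^2 = sinh^2 x (1 + sinh^2 x) = - v (1 - v)]. *)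
Lemma chart_center : chart phi sinh2_lt1 (gauss_series a b c%:C) (fun=> 1)
  (fun x => - sinhR x ^+ 2) (fun x => sinhR x * coshR x) 0
  (fun=> -2) (fun y => - y * (1 - y)).
Proof.
have [aF F0] := analyticc_gauss_series a b c0.
have v1 x : sinh2_lt1 x -> `|- sinhR x ^+ 2| < 1.
  by move=> xU; rewrite normrN ger0_norm ?sqr_ge0.
split=> //.
- exact: open_sinh2_lt1.
- exact: analytic_cst.
- apply: analyticM; first by apply: analyticN; exact: analytic_id.
  by apply: analyticD; [exact: analytic_cst|apply: analyticN; exact: analytic_id].
- by rewrite oppr0 mul0r.
- by move=> x /v1 xU; rewrite /phi /gauss_2F1 xU mul1r.
- by move=> x _; rewrite !mulr0; exact: is_derivec_cst.
- move=> x _.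
  apply: (is_derive_eq (is_derive_oppf (is_derive_mulf (is_derive_sinh x) (is_derive_sinh x)))).
  by ring.
- by move=> x _; apply: cvgM; [exact: cont_sinh|exact: cont_cosh].
- by move=> x _; rewrite exprMn cosh2; ring.
Qed.

Lemma tanh2E (x : R) : tanhR x * tanhR x = - sinhR x ^+ 2 / (- sinhR x ^+ 2 - 1).
Proof.
have /eqP := cosh2 x; have := cosh_gt0 x; have := sqr_ge0 (sinhR x).
rewrite /tanhR; move: (coshR x) (sinhR x) => p q q0 p0 /eqP pq.
have -> : q / p * (q / p) = q ^+ 2 / p ^+ 2 by field; exact: lt0r_neq0.
rewrite pq; field; apply/andP; split; apply/eqP; lra.
Qed.

(** Pfaff's transformation has the factor [(cosh^2 x)^(- a)], of logarithmic
    derivative [-2 a tanh x], and the variable [tanh^2 x], of derivative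
    [2 tanh x (1 - tanh^2 x)]; so [tau = tanh x]. *)
Lemma chart_outer : chart phi sinh2_gt1 (gauss_series a (c%:C - b) c%:C)
  (fun x => expc (- a * (ln (1 - - sinhR x ^+ 2))%:C))
  (fun x => tanhR x * tanhR x) tanhR (- a * 2)
  (fun y => 2 * (1 - y)) id.
Proof.
have [aF F0] := analyticc_gauss_series a (c%:C - b) c0.
split.
- exact: open_sinh2_gt1.
- exact: aF.
- exact: F0.
- apply: analyticM; first exact: analytic_cst.
  by apply: analyticD; [exact: analytic_cst|apply: analyticN; exact: analytic_id].
- exact: analytic_id.
- by [].
- move=> x _; rewrite -expr2 /tanhR expr_div_n ger0_norm; last first.
    by rewrite divr_ge0 ?sqr_ge0.
  by rewrite ltr_pdivrMr ?exprn_gt0 ?cosh_gt0// mul1r cosh2 ltrDr.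
- move=> x xU; rewrite /phi /gauss_2F1.
  have -> : (`|- sinhR x ^+ 2| < 1) = false.
    by rewrite normrN (ger0_norm (sqr_ge0 _)) ltNge (ltW xU).
  by rewrite tanh2E.
- by move=> x _; exact: expc_neq0.
- move=> x _; apply: is_derivec_expc.
  have d1 : is_derive x 1 (fun x => ln (1 - - sinhR x ^+ 2)) (2 * tanhR x).
    have p0 : 0 < 1 - - sinhR x ^+ 2 by rewrite opprK ltr_pwDl ?sqr_ge0.
    have d2 : is_derive x 1 (fun x => 1 - - sinhR x ^+ 2) (2 * (sinhR x * coshR x)).
      apply: (is_derive_eq (is_derive_addf (is_derive_cst (1:R) x 1) (is_derive_oppf
        (is_derive_oppf (is_derive_mulf (is_derive_sinh x) (is_derive_sinh x)))))).
      by ring.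
    apply: (is_derive_eq (is_derive1_comp (g := fun x => 1 - - sinhR x ^+ 2)
      (is_derive1_ln p0) d2)).
    rewrite opprK -cosh2 /tanhR; field; exact: lt0r_neq0 (cosh_gt0 x).
  have := is_derivec_mul (is_derivec_cst (- a) x) (is_derivec_real d1).
  rewrite mul0r add0r (_ : - a * (2 * tanhR x)%:C = (tanhR x)%:C * (- a * 2))//.
  by rewrite rmorphM/= rmorph_nat; ring.
- move=> x _.
  apply: (is_derive_eq (is_derive_mulf (is_derive_tanh x) (is_derive_tanh x))).
  by ring.
- by move=> x _; exact: derivable_cont (is_derive_tanh x).
- by move=> x _; rewrite expr2.
Qed.

Variable l : C.
Let psi (x : R) := phi x - i_C / l * derivec phi x.

Lemma countable_psi_zeros : countable [set x | psi x = 0].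
Proof.
have [Z1 [Z1c H1]] := psi_zeros chart_center l.
have [Z2 [Z2c H2]] := psi_zeros chart_outer l.
apply: (@sub_countable _ _ _ (([set x | sinh2_lt1 x /\ Z1 (- sinhR x ^+ 2)] `|`
  [set x | sinh2_gt1 x /\ Z2 (tanhR x * tanhR x)]) `|` [set x | sinhR x ^+ 2 = 1])).
  apply: subset_card_le => x px.
  have [x1|x1|x1] := ltgtP (sinhR x ^+ 2) 1; last by right.
  - by left; left; split=> //; exact: H1.
  - by left; right; split=> //; exact: H2.
apply: countable_setU; last exact: countable_sinh2_eq1.
apply: countable_setU.
- by apply: (@countable_preimage_sinh2 _ _ -%R) => // x _; rewrite opprK.
- apply: (@countable_preimage_sinh2 _ _ (fun y => y / (1 - y))) => // x _.
  rewrite -expr2 /tanhR expr_div_n.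
  have := cosh2 x; have := cosh_gt0 x; move: (coshR x) (sinhR x) => p q p0 pq.
  have p2 : p ^+ 2 != 0 by rewrite expf_neq0// gt_eqF.
  have -> : 1 - q ^+ 2 / p ^+ 2 = (p ^+ 2)^-1.
    by rewrite -[in LHS](divff p2) -mulrBl pq addrK mul1r.
  by rewrite invrK divfK.
Qed.

Lemma measurable_countable (D : set R) (f : R -> R) : countable D -> measurable_fun D f.
Proof.
move=> cD mD Y mY; apply: countable_measurable; first exact: measurable_set1.
by apply: sub_countable cD; apply: subset_card_le => x [].
Qed.

Lemma measurablec_psi : measurablec psi.
Proof.
have key (f : R -> R) : (forall x, sinh2_lt1 x -> continuous_at x f) ->
    (forall x, sinh2_gt1 x -> continuous_at x f) -> measurable_fun [set: R] f.
  move=> h1 h2.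
  rewrite (_ : [set: R] = (sinh2_lt1 `|` sinh2_gt1) `|` [set x | sinhR x ^+ 2 = 1]); last first.
    apply/seteqP; split=> // x _.
    by have [x1|x1|x1] := ltgtP (sinhR x ^+ 2) 1; [left; left|left; right|right].
  have m1 : measurable sinh2_lt1 by apply: open_measurable; exact: open_sinh2_lt1.
  have m2 : measurable sinh2_gt1 by apply: open_measurable; exact: open_sinh2_gt1.
  have m3 : measurable [set x : R | sinhR x ^+ 2 = 1].
    by apply: countable_measurable countable_sinh2_eq1; exact: measurable_set1.
  apply/measurable_funU => //; first exact: measurableU.
  split; last by apply: measurable_countable; exact: countable_sinh2_eq1.
  apply/measurable_funU => //; split.
  - apply: open_continuous_measurable_fun; first exact: open_sinh2_lt1.
    by move=> x /set_mem; exact: h1.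
  - apply: open_continuous_measurable_fun; first exact: open_sinh2_gt1.
    by move=> x /set_mem; exact: h2.
split; apply: key => x xU.
- by have [] := psi_contc chart_center l xU.
- by have [] := psi_contc chart_outer l xU.
- by have [] := psi_contc chart_center l xU.
- by have [] := psi_contc chart_outer l xU.
Qed.

End Kernel.

(** * The linear canonical kernel *)

Section LinearCanonicalKernel.
Variable R : realType.
Local Notation C := R[i].
Variables alpha beta : R.
Hypothesis halpha : - (1 / 2) < alpha.

Let alpha1_gt0 : 0 < alpha + 1.
Proof. by move: halpha; lra. Qed.

Lemma jacobi_dunkl_kernel_zeros (lambda : C) :
  countable [set x | jacobi_dunkl_kernel alpha beta lambda x = 0].
Proof.
rewrite /jacobi_dunkl_kernel; case: eqVneq => [_|_].
  apply: sub_countable (@countable0 R); apply: subset_card_le => x /eqP.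
  by rewrite oner_eq0.
set m := sqrtc _; pose rho := (jacobi_rho alpha beta)%:C.
exact: (@countable_psi_zeros _ ((rho + (0 +i* 1) * m) / 2%:R)
  ((rho - (0 +i* 1) * m) / 2%:R) _ alpha1_gt0).
Qed.

Lemma measurablec_jacobi_dunkl_kernel (lambda : C) :
  measurablec (jacobi_dunkl_kernel alpha beta lambda).
Proof.
rewrite /jacobi_dunkl_kernel; case: eqVneq => [_|_].
  by split; exact: measurable_cst.
set m := sqrtc _; pose rho := (jacobi_rho alpha beta)%:C.
exact: (@measurablec_psi _ ((rho + (0 +i* 1) * m) / 2%:R)
  ((rho - (0 +i* 1) * m) / 2%:R) _ alpha1_gt0).
Qed.

Lemma lc_kernel_zeros (M : 'M[R]_2) (lambda : C) :
  countable [set x | lc_kernel alpha beta M x lambda = 0].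
Proof.
rewrite /lc_kernel; case: (M 1 0 != 0); last exact: jacobi_dunkl_kernel_zeros.
apply: sub_countable (jacobi_dunkl_kernel_zeros (- lambda / (M 1 0)%:C)).
apply: subset_card_le => x /= /eqP; rewrite mulf_eq0 => /orP[e0|/eqP//].
by move: e0; rewrite (negbTE (expc_neq0 _)).
Qed.

Lemma measurablec_lc_kernel (M : 'M[R]_2) (lambda : C) :
  measurablec (fun x => lc_kernel alpha beta M x lambda).
Proof.
rewrite /lc_kernel; case: (M 1 0 != 0); last exact: measurablec_jacobi_dunkl_kernel.
apply: measurablecM; last exact: measurablec_jacobi_dunkl_kernel.
have H x : contc (fun x => expc (- ((0 +i* 1) / (2 * M 0 1)%:C) *
    ((M 0 0 * x ^+ 2)%:C + (M 1 1)%:C * lambda ^+ 2))) x.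
  apply: contc_expc; apply: contcM; first exact: contc_cst.
  apply: contcD; last exact: contc_cst.
  apply: contc_real; apply: (derivable_cont (is_derive_mulc (M 0 0) (is_derive_expn 1 x))).
by split; apply: continuous_measurable_fun => x; have [] := H x.
Qed.

Lemma measurable_jacobi_weight : measurable_fun [set: R] (jacobi_weight alpha beta).
Proof.
have ms : measurable_fun [set: R] (fun x : R => sinhR `|x|).
  apply: (@measurableT_comp _ _ _ _ _ _ (@sinhR R)) => //.
  by apply: continuous_measurable_fun => x; exact: cont_sinh.
have mc : measurable_fun [set: R] (@coshR R).
  by apply: continuous_measurable_fun => x; exact: cont_cosh.
apply: measurable_funM; first apply: measurable_funM.
- exact: measurable_cst.
- exact: (measurableT_comp (measurable_powR _) ms).
- exact: (measurableT_comp (measurable_powR _) mc).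
Qed.

Lemma jacobi_weight_neq0 (x : R) : x != 0 -> jacobi_weight alpha beta x != 0.
Proof.
move=> x0; rewrite gt_eqF// !mulr_gt0// powR_gt0//.
- by apply: sinh_gt0; rewrite normr_gt0.
- exact: cosh_gt0.
Qed.

Definition weighted_kernel (M : 'M[R]_2) (lambda : C) (x : R) : C :=
  lc_kernel alpha beta M x lambda * (jacobi_weight alpha beta x)%:C.

Lemma measurablec_weighted_kernel M lambda : measurablec (weighted_kernel M lambda).
Proof.
apply: measurablecM; first exact: measurablec_lc_kernel.
by split=> /=; [exact: measurable_jacobi_weight|exact: measurable_cst].
Qed.

Lemma weighted_kernel_neq0 M lambda :
  {ae @lebesgue_measure R, forall x, weighted_kernel M lambda x != 0}.
Proof.
pose Z := [set x | lc_kernel alpha beta M x lambda = 0] `|` [set (0 : R)].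
have cZ : countable Z.
  by apply: countable_setU; [exact: lc_kernel_zeros|exact: countable1].
exists Z; split.
- by apply: countable_measurable cZ; exact: measurable_set1.
- exact: countable_lebesgue_measure0.
- move=> x /= /negP; rewrite negbK mulf_eq0 => /orP[/eqP|]; first by left.
  rewrite fmorph_eq0; have [->|x0] := eqVneq x 0; first by right.
  by rewrite (negbTE (jacobi_weight_neq0 x0)).
Qed.

End LinearCanonicalKernel.

(** * The convolution theorem *)

Lemma mul_regroup (K : comPzRingType) (f r p q u v w : K) :
  f * r * (p * q * u * w * v) = f * q * v * (r * p * u) * w.
Proof. by ring. Qed.

Theorem theorem4p3 (R : realType) (alpha beta : R)
    (halpha : - (1 / 2) < alpha) (hbeta : - (1 / 2) <= beta)
    (hab : beta < alpha)
    (M : 'M[R]_2) (hdet : \det M = 1)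
    (hM : M 1 0 != 0 -> M 0 1 != 0)
    (lambda : R[i]) (f r : R -> R[i])
    (hf : Lp_jacobi 2 alpha beta f) (hr : Lp_jacobi 2 alpha beta r)
    (hLf : lc_transformable alpha beta M f lambda)
    (hLr : lc_transformable alpha beta M r lambda) :
  [/\ {ae @lebesgue_measure R, forall x,
         integrablec (lc_conv_integrand alpha beta M lambda f r x)},
      lc_transformable alpha beta M (lc_conv alpha beta M lambda f r) lambda &
      lc_transform alpha beta M (lc_conv alpha beta M lambda f r) lambda =
      lc_transform alpha beta M f lambda * lc_transform alpha beta M r lambda].
Proof.
pose k := weighted_kernel alpha beta M lambda.
pose F := lc_integrand alpha beta M f lambda.
pose G := lc_integrand alpha beta M r lambda.
have convE x : lc_conv_integrand alpha beta M lambda f r x =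
    fun t => F t * G (x - t) * (k x)^-1.
  by apply/funext => t; exact: mul_regroup.
have mk := measurablec_weighted_kernel beta halpha M lambda.
have k0 := weighted_kernel_neq0 beta halpha M lambda.
have transE : lc_integrand alpha beta M (lc_conv alpha beta M lambda f r) lambda =
    fun x => integralc (fun t => F t * G (x - t) * (k x)^-1) * k x.
  by apply/funext => x; rewrite /lc_integrand /lc_conv convE -mulrA.
have [ti tE] := weighted_convolution hLf hLr mk k0.
split.
- apply: ae_imply (ae_integrablec_weighted k hLf hLr) => x.
  by rewrite convE.
- by rewrite /lc_transformable transE.
- by rewrite /lc_transform transE.
Qed.
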